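(* Let $\alpha\in[0,2]$ and let $\mathcal X\subseteq\mathcal H$ be a vector subspace equipped with its own norm $\|\cdot\|_{\mathcal X}$. Then there exists a constant $B>0$ such that $$\|P_{t,s}-P\|_{\mathcal X\to\mathcal H}^2\le B(t-s)^{-\alpha}\quad\text{for all real } t>s$$ if and only if - in the case $\alpha\in[0,2)$: $I-P$ maps $\mathcal X$ continuously into $\mathcal X_\alpha$, i.e. $(I-P)\mathcal X\subseteq\mathcal X_\alpha$ and there is a constant $C$ with $\|(I-P)f\|_{\mathcal X_\alpha}\le C\|f\|_{\mathcal X}$ for all $f\in\mathcal X$; - in the case $\alpha=2$: $I-P$ maps $\mathcal X$ continuously into $\mathcal Y$, i.e. $(I-P)\mathcal X\subseteq\mathcal Y$ and there is a constant $C$ with $\|(I-P)f\|_{\mathcal Y}\le C\|f\|_{\mathcal X}$ for all $f\in\mathcal X$.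
   Context: $\mathcal H$ is a complex Hilbert space and $\{U^t\}_{t\in\mathbb R}$ is a strongly continuous group of unitary operators on $\mathcal H$. For $f\in\mathcal H$ and real $t>s$ put $P_{t,s}f=\frac1{t-s}\int_s^tU^\tau f\,d\tau$. $P$ is the orthogonal projection of $\mathcal H$ onto the subspace of vectors fixed by all $U^t$; $I$ is the identity. By Stone's theorem $U^t=e^{it\mathbf B}$ with $\mathbf B$ self-adjoint (the infinitesimal generator); let $E$ be its spectral resolution, so that $(U^tf,g)_{\mathcal H}=\int_{\mathbb R}e^{it\lambda}\,d(E(\lambda)f,g)_{\mathcal H}$. For $h\in\mathcal H$, the spectral measure $\sigma_h$ is the finite Borel measure on $\mathbb R$ given by $\sigma_h(C)=\int_C d(E(\lambda)h,h)_{\mathcal H}$; $\sigma_h(-\delta,\delta]$ denotes $\sigma_h((-\delta,\delta])$. For an operator $T$ on $\mathcal H$, $\|T\|_{\mathcal X\to\mathcal H}=\sup_{f\in\mathcal X,\,f\ne0}\|Tf\|_{\mathcal H}/\|f\|_{\mathcal X}$. For $\alpha\ge0$, $\mathcal X_\alpha=\{f\in\mathcal H:\ \exists A>0\ \forall\delta>0\ \ \sigma_f(-\delta,\delta]\le A\delta^\alpha\}$, a vector subspace of $\mathcal H$ with the norm $\|f\|_{\mathcal X_\alpha}^2=\inf\{A:\ \forall\delta>0\ \ \sigma_f(-\delta,\delta]\le A\delta^\alpha\}$ (for $\alpha=0$ this is $\mathcal X_0=\mathcal H$ with $\|\cdot\|_{\mathcal X_0}=\|\cdot\|_{\mathcal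 H}$). $\mathcal Y$ is the range $\mathcal R(\mathbf B)$ of $\mathbf B$ with the norm $\|f\|_{\mathcal Y}=\sup_{t>0}\left\|\int_0^tU^\tau f\,d\tau\right\|_{\mathcal H}$, which is finite for every $f\in\mathcal R(\mathbf B)$. *)

(* Defs.v *)
From HB Require Import structures.
From mathcomp Require Import all_boot all_order all_algebra.
From mathcomp Require Import complex.
From mathcomp Require Import all_classical all_reals all_analysis.

Set Implicit Arguments.
Unset Strict Implicit.
Unset Printing Implicit Defensive.

Import Order.TTheory GRing.Theory Num.Theory.
Import numFieldNormedType.Exports.

Local Open Scope classical_set_scope.
Local Open Scope ring_scope.
Local Open Scope complex_scope.

(* A complex Hilbert space is a complete normed space over [R[i]] whose norm
   comes from an inner product, linear in its first argument. *)
Record innerProduct (R : realType) (H : completeNormedModType R[i]) :=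
  InnerProduct {
    dot :> {dot H for (@Num.conj R[i])} ;
    dot_norm : forall x : H, `|x| ^+ 2 = dot x x }.

(* The norm of a space over [R[i]] takes values in [R[i]]; this is the same
   norm seen as a real number. *)
Definition rnorm (R : realType) (V : normedModType R[i]) (x : V) : R :=
  complex.Re `|x|.

Lemma rnormE (R : realType) (V : normedModType R[i]) (x : V) :
  (rnorm x)%:C = `|x|.
Proof. by rewrite /rnorm RRe_real//. Qed.

Lemma rnorm_ge0 (R : realType) (V : normedModType R[i]) (x : V) :
  0 <= rnorm x.
Proof. by rewrite -lecR rnormE; exact: normr_ge0. Qed.

Lemma rnorm_dist (R : realType) (V : normedModType R[i]) (x y : V) :
  `|rnorm x - rnorm y| <= rnorm (x - y).
Proof.
rewrite ler_norml; apply/andP; split; last first.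
  by rewrite lerBlDr -lecR rmorphD/= !rnormE -{1}(subrK y x) ler_normD.
rewrite lerNl opprB lerBlDr -lecR rmorphD/= !rnormE distrC.
by rewrite -{1}(subrK x y) ler_normD.
Qed.

Section RiemannIntegral.
Context {R : realType} {H : completeNormedModType R[i]}.
Implicit Types (F : R -> H) (a b : R) (s : seq R) (xi : nat -> R).

Definition node a s (i : nat) : R := nth a (a :: s) i.

Definition riemann_sum F a s xi : H :=
  \sum_(i < size s) (node a s i.+1 - node a s i)%:C *: F (xi i).

Definition is_RInt F a b (v : H) :=
  forall e : R, 0 < e -> exists2 d : R, 0 < d &
    forall s xi, itv_partition a b s ->
      (forall i, (i < size s)%N -> node a s i <= xi i <= node a s i.+1) ->
      (forall i, (i < size s)%N -> node a s i.+1 - node a s i < d) ->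
      rnorm (riemann_sum F a s xi - v) < e.

(* Meaningful for [a <= b]; the value is 0 if [F] is not integrable. *)
Definition RInt F a b : H := xget 0 (is_RInt F a b).

End RiemannIntegral.

Section UnitaryGroup.
Context {R : realType} {H : completeNormedModType R[i]}.
Variable ip : innerProduct H.

Definition unitary (T : H -> H) :=
  (forall f g, ip (T f) (T g) = ip f g) /\ (forall g, exists f, T f = g).

Record unitary_group (U : R -> {linear H -> H}) := UnitaryGroup {
  ug_unitary : forall t, unitary (U t) ;
  ug0 : forall f, U 0 f = f ;
  ugD : forall s t f, U (s + t) f = U s (U t f) ;
  ug_continuous : forall f, continuous (fun t => U t f) }.

Definition is_orth_proj (V : set H) (P : H -> H) :=
  forall f, V (P f) /\ forall g, V g -> ip (f - P f) g = 0.

End UnitaryGroup.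

Definition fixed_vectors (R : realType) (H : completeNormedModType R[i])
    (U : R -> {linear H -> H}) : set H :=
  [set f | forall t, U t f = f].

Definition time_avg (R : realType) (H : completeNormedModType R[i])
    (U : R -> {linear H -> H}) (t s : R) (f : H) : H :=
  ((t - s)^-1)%:C *: RInt (fun tau => U tau f) s t.

(* The graph of the self-adjoint generator [B], where [U t = exp (i t B)]:
   [f] is in the domain of [B] and [B f = g]. *)
Definition generator_graph (R : realType) (H : completeNormedModType R[i])
    (U : R -> {linear H -> H}) (f g : H) :=
  (0 +i* h)^-1 *: (U h f - f) @[h --> (0 : R)^'] --> g.

Definition generator_range (R : realType) (H : completeNormedModType R[i])
    (U : R -> {linear H -> H}) : set H :=
  [set g | exists f, generator_graph U f g].

(* A resolution of the identity, right-continuous in the strong topology. *)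
Record resolution (R : realType) (H : completeNormedModType R[i])
    (ip : innerProduct H) := Resolution {
  res_proj :> R -> {linear H -> H} ;
  res_idem : forall l f, res_proj l (res_proj l f) = res_proj l f ;
  res_sym : forall l f g, ip (res_proj l f) g = ip f (res_proj l g) ;
  res_mono : forall l m f, l <= m -> res_proj l (res_proj m f) = res_proj l f ;
  res_rcont : forall l f, res_proj m f @[m --> l^'+] --> res_proj l f ;
  res_ninfty : forall f, res_proj l f @[l --> -oo] --> (0 : H) ;
  res_pinfty : forall f, res_proj l f @[l --> +oo] --> f }.

Section SpectralMeasure.
Context {R : realType} {H : completeNormedModType R[i]}.
Context {ip : innerProduct H}.
Variable E : resolution ip.

(* [ip (E l h) h] is a nonnegative real number. *)
Definition spectral_cdf (h : H) (l : R) : R := complex.Re (ip (E l h) h).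

Lemma spectral_cdfE h l : spectral_cdf h l = rnorm (E l h) ^+ 2.
Proof.
by rewrite /spectral_cdf -res_idem res_sym -dot_norm -rnormE -rmorphXn/= res_idem.
Qed.

Lemma spectral_cdf_nd h : {homo spectral_cdf h : l m / l <= m}.
Proof.
move=> l m lm; rewrite !spectral_cdfE -(res_mono E h lm).
set g := E m h; rewrite ler_sqr ?nnegrE ?rnorm_ge0//.
rewrite -lecR !rnormE -(ler_pXn2r (ltn0Sn 1)) ?nnegrE//.
have o : ip (E l g) (g - E l g) = 0.
  by rewrite res_sym linearB/= res_idem subrr linear0r.
have -> : `|g| ^+ 2 = `|E l g| ^+ 2 + `|g - E l g| ^+ 2.
  rewrite -{1}(subrK (E l g) g) addrC !(dot_norm ip).
  exact: (@hnormDd _ _ _ _ ip).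
by rewrite lerDl exprn_ge0.
Qed.

Lemma spectral_cdf_rc h : right_continuous (spectral_cdf h).
Proof.
move=> l.
rewrite (_ : spectral_cdf h = fun l => rnorm (E l h) * rnorm (E l h)); last first.
  by apply/funext => m; rewrite spectral_cdfE expr2.
suff c : rnorm (E m h) @[m --> l^'+] --> rnorm (E l h) by exact: cvgM.
apply/cvgrPdist_lt => e e0.
have e0C : 0 < e%:C by rewrite ltcR.
near=> m.
have : `|E l h - E m h| < e%:C.
  by near: m; move/cvgrPdist_lt : (@res_rcont _ _ _ E l h); apply.
by rewrite -rnormE ltcR; apply: le_lt_trans; exact: rnorm_dist.
Unshelve. all: by end_near. Qed.

HB.instance Definition _ (h : H) := isCumulative.Build R _ R (spectral_cdf h)
  (@spectral_cdf_nd h) (@spectral_cdf_rc h).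

Definition spectral_measure (h : H) : {measure set (measurableTypeR R) -> \bar R} :=
  lebesgue_stieltjes_measure (spectral_cdf h).

Definition cintegral (mu : {measure set (measurableTypeR R) -> \bar R})
    (phi : R -> R[i]) : R[i] :=
  Rintegral mu setT (fun l => complex.Re (phi l))
  +i* Rintegral mu setT (fun l => complex.Im (phi l)).

(* The integral of [phi] with respect to the complex measure
   [d(E(l)f, g)], which by polarization is
   [1/4 \sum_(k < 4) i^k d(E(l)(f + i^k g), f + i^k g)]. *)
Definition resolution_integral (phi : R -> R[i]) (f g : H) : R[i] :=
  4^-1 * \sum_(k < 4)
    (0 +i* 1) ^+ k * cintegral (spectral_measure (f + (0 +i* 1) ^+ k *: g)) phi.

Definition cexpi (x : R) : R[i] := cos x +i* sin x.

(* The spectral resolution of the generator of [U] is the unique resolution of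
   the identity with this property (Stone). *)
Definition is_spectral_resolution (U : R -> {linear H -> H}) :=
  forall t f g,
    ip (U t f) g = resolution_integral (fun l => cexpi (t * l)) f g.

Definition Xbound (alpha : R) (f : H) (A : R) :=
  forall d : R, 0 < d ->
    (spectral_measure f `](- d)%R, d]%classic <= (A * d `^ alpha)%:E)%E.

Definition Xset (alpha : R) : set H :=
  [set f | exists2 A : R, 0 < A & Xbound alpha f A].

(* As [inf] is real-valued, meaningful for [f] in [Xset alpha]. *)
Definition Xnorm (alpha : R) (f : H) : R := Num.sqrt (inf (Xbound alpha f)).

End SpectralMeasure.

(* As [sup] is real-valued, meaningful for [f] in [generator_range U], where
   the supremum is finite. *)
Definition Ynorm (R : realType) (H : completeNormedModType R[i])
    (U : R -> {linear H -> H}) (f : H) : R :=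
  sup [set rnorm (RInt (fun tau => U tau f) 0 t) | t in [set t : R | 0 < t]].

Record is_norm_on (R : realType) (H : completeNormedModType R[i])
    (X : set H) (N : H -> R) := IsNormOn {
  norm_on0 : forall f, X f -> N f = 0 -> f = 0 ;
  norm_onD : forall f g, X f -> X g -> N (f + g) <= N f + N g ;
  norm_onZ : forall (c : R[i]) f, X f -> N (c *: f) = complex.Re `|c| * N f }.

(* The value 0 is adjoined so that the norm is 0 when [X = {0}], the set of
   quotients being then empty. *)
Definition opnorm (R : realType) (H : completeNormedModType R[i])
    (X : set H) (N : H -> R) (T : H -> H) : \bar R :=
  ereal_sup (0%E |` [set (rnorm (T f) / N f)%:E | f in X `&` [set~ 0]]).

Definition maps_continuously_into (R : realType)
    (H : completeNormedModType R[i]) (X : set H) (NX : H -> R)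
    (Z : set H) (NZ : H -> R) (T : H -> H) :=
  T @` X `<=` Z /\
  exists C : R, forall f, X f -> NZ (T f) <= C * NX f.

(* Main.v *)
Require Import Defs.
From mathcomp Require Import all_boot all_order all_algebra.
From mathcomp Require Import complex ring lra.
From mathcomp Require Import all_classical all_reals all_analysis.
From mathcomp Require Import measurable_realfun.
Import Order.TTheory GRing.Theory Num.Theory.
Import numFieldNormedType.Exports.
Local Open Scope classical_set_scope.
Local Open Scope ring_scope.

(** The spectral side of the problem is the formula
[rnorm (\int_0^T U t h dt) ^+ 2 = \int `|(exp ('i T l) - 1) / l| ^+ 2 d sigma_h(l)] with [h = f - P f].
Indeed [time_avg U t s f - P f] is, up to the isometry [U s], the integral [G (t - s)] of the
orbit of [h] divided by [t - s] ([time_avg_fixed]), so the rate condition is a bound on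
[rnorm (G T) ^+ 2] by a multiple of [T ^+ 2 * T `^ (- alpha) * NX f ^+ 2] ([time_avg_rateP]).

The integral formula is only used for Riemann sums, where it is a finite expansion of a
square ([rnorm_orbit_sum]), and as a pair of inequalities.  The kernel is at least [T ^+ 2 / 4] for
[`|l| <= T^-1], so that decay of [G T] bounds the measure of that neighbourhood of 0
([spectral_measure_le_primitive]).  Conversely the kernel is at most the minimum of [T ^+ 2] and a
multiple of [l ^- 2]; summing over dyadic neighbourhoods of 0, the growth condition
[Xbound] bounds [G T], the resulting geometric series having ratio [2 `^ (alpha - 2)], less than 1
exactly when [alpha < 2] ([primitive_le_Xbound]).

For [alpha = 2] the series diverges and the condition says instead that [G] is bounded.
If [h] is the image of [g] under the generator then [G t = - 'i *: (U t g - g)]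
([generator_primitive]), which is bounded.  Conversely a bounded [G] is a bounded cocycle of the isometric
group [U], and [bounded_cocycle_coboundary] solves [U t g - g = G t]: the maps
[x |-> U t x - G t] are affine isometries preserving a bounded orbit, and the asymptotic
centre of this orbit, unique by the parallelogram identity, is fixed by them.

The integrals themselves are produced from primitives: a uniformly continuous bounded
function with values in a Banach space has a primitive, the limit of its grid sums
([exists_primitive]), and the increments of a primitive are Riemann integrals
([primitive_is_RInt]). *)

Set Implicit Arguments.
Unset Strict Implicit.
Unset Printing Implicit Defensive.

(** * The norm as a real number *)

Section RealNorm.
Local Open Scope complex_scope.
Context {R : realType} {H : completeNormedModType R[i]}.
Implicit Types (x y : H) (a : R) (c : R[i]).

Lemma rnormD x y : rnorm (x + y) <= rnorm x + rnorm y.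
Proof. by rewrite -lecR rmorphD/= !rnormE ler_normD. Qed.

Lemma rnormN x : rnorm (- x) = rnorm x.
Proof. by rewrite /rnorm normrN. Qed.

Lemma rnormB x y : rnorm (x - y) = rnorm (y - x).
Proof. by rewrite /rnorm distrC. Qed.

Lemma rnorm0 : rnorm (0 : H) = 0.
Proof. by rewrite /rnorm normr0. Qed.

Lemma rnorm0_eq0 x : rnorm x = 0 -> x = 0.
Proof. by move=> x0; apply/eqP; rewrite -normr_eq0 -rnormE x0. Qed.

Lemma rnormZ c x : rnorm (c *: x) = complex.Re `|c| * rnorm x.
Proof.
by apply: complexI; rewrite rmorphM/= !rnormE normrZ; congr (_ * _); rewrite RRe_real ?normr_real.
Qed.

Lemma rnormZr a x : rnorm (a%:C *: x) = `|a| * rnorm x.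
Proof. by rewrite rnormZ normc_def/= expr0n/= addr0 sqrtr_sqr. Qed.

Lemma rnorm_sum n (F : nat -> H) :
  rnorm (\sum_(i < n) F i) <= \sum_(i < n) rnorm (F i).
Proof.
elim: n => [|n ih]; first by rewrite !big_ord0 rnorm0.
by rewrite !big_ord_recr/=; apply: le_trans (rnormD _ _) _; rewrite lerD2r.
Qed.

Lemma rnorm_small_eq x y : (forall e, 0 < e -> rnorm (x - y) <= e) -> x = y.
Proof.
move=> small; apply/eqP; rewrite -subr_eq0; apply/eqP/rnorm0_eq0/eqP.
rewrite eq_le rnorm_ge0 andbT; apply/ler_addgt0Pl => e /small.
by rewrite addr0.
Qed.

Lemma cvg_rnormP {T : Type} {F : set_system T} {FF : Filter F} (f : T -> H) x :
  f @ F --> x <-> forall e : R, 0 < e -> \forall t \near F, rnorm (x - f t) < e.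
Proof.
split=> [/cvgrPdist_lt fx e e0|fx].
  by have := fx e%:C; rewrite ltcR => /(_ e0); apply: filterS => t; rewrite -rnormE ltcR.
apply/cvgrPdist_lt => e e0.
have eE : e = (complex.Re e)%:C by rewrite RRe_real// gtr0_real.
have : 0 < complex.Re e by rewrite -ltcR -eE.
by move/fx; apply: filterS => t; rewrite -rnormE eE ltcR.
Qed.

(** Local errors add up: this turns a local estimate on increments into
a global estimate between an increment and a Riemann sum. *)
Lemma rnorm_telescope (v w : nat -> H) (c : nat -> R) n :
  (forall i, (i < n)%N -> rnorm (v i.+1 - v i - w i) <= c i) ->
  rnorm (v n - v 0 - \sum_(i < n) w i) <= \sum_(i < n) c i.
Proof.
elim: n => [|n ih] le_c; first by rewrite !big_ord0 subrr subr0 rnorm0.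
rewrite !big_ord_recr/=.
have -> : v n.+1 - v 0 - (\sum_(i < n) w i + w n) =
    (v n - v 0 - \sum_(i < n) w i) + (v n.+1 - v n - w n).
  by rewrite addrACA -opprD [v n - v 0 + _]addrC subrKA.
apply: le_trans (rnormD _ _) _; apply: lerD; last exact: le_c.
by apply: ih => i ilt; apply: le_c; rewrite ltnS ltnW.
Qed.

End RealNorm.

(** * Primitives of Banach-valued functions *)

Section Primitive.
Local Open Scope complex_scope.
Context {R : realType} {H : completeNormedModType R[i]}.
Implicit Types (F G : R -> H) (d e M p q x y : R).

Lemma rnorm_cauchy_cvg (u : nat -> H) :
  (forall e, 0 < e -> exists N, forall n, (N <= n)%N -> rnorm (u N - u n) < e) ->
  exists l : H, u @ \oo --> l.
Proof.
move=> cu; suff : cvg (u @ \oo) by move=> ?; exists (lim (u @ \oo)).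
apply/cauchy_cvgP/cauchy_exP => e e0.
have eE : e = (complex.Re e)%:C by rewrite RRe_real// gtr0_real.
have : 0 < complex.Re e by rewrite -ltcR -eE.
move=> /cu[N uN]; exists (u N); exists N => // n /= Nn.
by rewrite -ball_normE/= -rnormE eE ltcR; exact: uN.
Qed.

Definition uniformly_continuous F := forall e, 0 < e ->
  exists2 d, 0 < d & forall x y, `|x - y| < d -> rnorm (F x - F y) <= e.

(** The indefinite integral of [F] on the half-line, characterised by the local
estimate that a Riemann sum needs.  The tag [x] is any point of the
interval, so that telescoping the estimate controls all tagged Riemann sums
at once. *)
Definition primitive F G := forall e, 0 < e -> exists2 d, 0 < d &
  forall p x q, 0 <= p -> p <= x -> x <= q -> q - p < d ->
    rnorm (G q - G p - (q - p)%:C *: F x) <= e * (q - p).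

Definition grid_sum F n (t : R) : H :=
  \sum_(0 <= i < Num.truncn (t * n.+1%:R))
    (n.+1%:R^-1)%:C *: F (i%:R / n.+1%:R).

(** The number of grid points between [p] and [q] differs from
[(q - p) * n.+1] by less than 1, which costs at most one term of norm
[M / n.+1]; at each of them [F] is within [e] of [F x]. *)
Lemma grid_sum_increment F e d M n p x q :
    (forall x y, `|x - y| < d -> rnorm (F x - F y) <= e) ->
    (forall x, rnorm (F x) <= M) -> 0 <= e ->
    n.+1%:R^-1 < d / 2 -> 0 <= p -> p <= x -> x <= q -> q - p < d / 2 ->
  rnorm (grid_sum F n q - grid_sum F n p - (q - p)%:C *: F x)
    <= e * (q - p) + (e + M) / n.+1%:R.
Proof.
move=> Fd FM e0 nd p0 px xq pqd.
set N := n.+1%:R in nd *; set a := N^-1 in nd *.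
have N0 : 0 < N by rewrite ltr0n.
have a0 : 0 < a by rewrite invr_gt0.
have q0 : 0 <= q by apply: le_trans p0 (le_trans px xq).
have /andP[kp pk] := truncn_itv (mulr_ge0 p0 (ltW N0)).
have /andP[lq ql] := truncn_itv (mulr_ge0 q0 (ltW N0)).
rewrite /grid_sum -/N -/a.
set k := Num.truncn _ in kp pk *; set l := Num.truncn _ in lq ql *.
have kl : (k <= l)%N.
  rewrite truncn_ge_nat ?mulr_ge0 ?(ltW N0)//.
  by apply: le_trans kp _; rewrite ler_wpM2r ?(ltW N0)// (le_trans px).
rewrite (big_cat_nat (leq0n k) kl)//= [X in X - _ - _]addrC addrK.
have scale (u v : R) : (u <= v * N) = (u * a <= v).
  by rewrite ler_pdivrMr.
have {}kp : k%:R * a <= p by rewrite -scale.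
have {}lq : l%:R * a <= q by rewrite -scale.
have {}pk : p < k%:R * a + a.
  by rewrite -{2}(mul1r a) -mulrDl ltr_pdivlMr// natr1.
have {}ql : q < l%:R * a + a.
  by rewrite -{2}(mul1r a) -mulrDl ltr_pdivlMr// natr1.
have -> : \sum_(k <= i < l) a%:C *: F (i%:R * a) - (q - p)%:C *: F x =
    \sum_(k <= i < l) a%:C *: (F (i%:R * a) - F x)
    + ((l - k)%:R * a - (q - p))%:C *: F x.
  under [in RHS]eq_bigr do rewrite scalerBr.
  have -> : ((l - k)%:R * a - (q - p))%:C *: F x =
      (a%:C *: F x) *+ (l - k) - (q - p)%:C *: F x.
    by rewrite rmorphB/= scalerBl rmorphM/= rmorph_nat -scalerA scaler_nat.
  by rewrite big_split/= sumr_const_nat mulNrn addrA subrK.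
apply: le_trans (rnormD _ _) _.
have -> : e * (q - p) + (e + M) * a = (e * (q - p) + e * a) + M * a by ring.
apply: lerD; last first.
  rewrite rnormZr mulrC; apply: ler_pM => //; first exact: rnorm_ge0.
  rewrite natrB// ler_norml; nra.
have -> : \sum_(k <= i < l) a%:C *: (F (i%:R * a) - F x) =
    \sum_(i < l - k) a%:C *: (F ((k + i)%:R * a) - F x).
  rewrite -{1}[k]add0n big_addn big_mkord.
  by apply: eq_bigr => i _; rewrite addnC.
apply: le_trans (rnorm_sum _ (fun i => a%:C *: (F ((k + i)%:R * a) - F x))) _.
apply: (@le_trans _ _ (\sum_(i < l - k) a * e)).
  apply: ler_sum => i _; rewrite rnormZr gtr0_norm// ler_pM2l//; apply: Fd.
  have il : ((k + i)%:R + 1 : R) <= l%:R.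
    by rewrite natr1 ler_nat -addnS -leq_subRL// ltn_ord.
  have ki : (k%:R : R) <= (k + i)%:R by rewrite ler_nat leq_addr.
  rewrite ltr_norml; nra.
rewrite sumr_const card_ord -mulr_natl natrB//; nra.
Qed.

End Primitive.

Lemma eventually_divS_lt {R : realType} (x c : R) : 0 < c ->
  exists N, forall n, (N <= n)%N -> x / n.+1%:R < c.
Proof.
move=> c0; exists (Num.truncn (`|x| / c)) => n; rewrite -ltnS => Nn.
rewrite ltr_pdivrMr ?ltr0n// mulrC -ltr_pdivrMr//.
apply: (@le_lt_trans _ _ (`|x| / c)); first by rewrite ler_pM2r ?invr_gt0// ler_norm.
by rewrite -truncn_lt_nat// divr_ge0// ltW.
Qed.

Section ExistenceOfPrimitive.
Local Open Scope complex_scope.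
Context {R : realType} {H : completeNormedModType R[i]}.
Implicit Types (F G : R -> H) (d e M p q x y t : R).

(** The error [c] per step makes the lemma apply both to grid sums, which are
primitives only approximately, and (with [c = 0]) to primitives. *)
Lemma rnorm_uniform_sum F G e d c t n : 0 <= t -> t / n.+1%:R < d ->
    (forall p q, 0 <= p -> p <= q -> q - p < d ->
      rnorm (G q - G p - (q - p)%:C *: F p) <= e * (q - p) + c) ->
  rnorm (G t - G 0 - \sum_(i < n.+1) (t / n.+1%:R)%:C *: F (i%:R * (t / n.+1%:R)))
    <= e * t + c *+ n.+1.
Proof.
move=> t0 td Gd; set a := t / _ in td *.
have a0 : 0 <= a by rewrite divr_ge0.
have step i : i.+1%:R * a - i%:R * a = a by rewrite -natr1; ring.
have na : n.+1%:R * a = t by rewrite mulrC divfK// pnatr_eq0.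
have -> : e * t + c *+ n.+1 = \sum_(i < n.+1) (e * a + c).
  by rewrite sumr_const card_ord mulrnDl -(mulr_natl (e * a)) mulrCA na.
have := @rnorm_telescope _ _ (fun i => G (i%:R * a))
  (fun i => a%:C *: F (i%:R * a)) (fun=> e * a + c) n.+1.
rewrite na mul0r; apply.
move=> i _; have := Gd (i%:R * a) (i.+1%:R * a).
by rewrite step; apply => //; rewrite ?mulr_ge0// -subr_ge0 step.
Qed.

(** The primitive is the limit of the grid sums.  They form a Cauchy sequence at
each [t] because, by [grid_sum_increment], all fine ones are close to one and
the same Riemann sum, taken over a fixed coarser partition of [[0, t]]. *)
Lemma exists_primitive F M : uniformly_continuous F ->
  (forall x, rnorm (F x) <= M) -> exists2 G, primitive F G & G 0 = 0.
Proof.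
move=> Fu FM.
have M0 : 0 <= M by exact: le_trans (rnorm_ge0 _) (FM 0).
have grid0 n : grid_sum F n 0 = 0 by rewrite /grid_sum mul0r truncn0 big_geq.
have Fcvg t : 0 <= t -> cvg (grid_sum F n t @[n --> \oo]).
  move=> t0; suff [l gl] : exists l : H, grid_sum F n t @[n --> \oo] --> l.
    by apply/cvg_ex; exists l.
  apply: rnorm_cauchy_cvg => e0 e0_gt0.
  (* [e] is such that the total error [e * t] over [[0, t]] is below [e0 / 4]. *)
  pose e := e0 / (4 * (t + 1)).
  have e_gt0 : 0 < e by rewrite divr_gt0// mulr_gt0// ltr_wpDl.
  have et : e * t < e0 / 4.
    have -> : e0 / 4 = e * (t + 1).
      by rewrite /e invfM mulrA -mulrA mulVf ?mulr1// gt_eqF// ltr_wpDl.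
    by rewrite ltr_pM2l// ltrDl.
  have [d d0 Fd] := Fu _ e_gt0.
  have d20 : 0 < d / 2 by rewrite divr_gt0.
  have [N tN] := eventually_divS_lt t d20.
  have [N1 N1P] := eventually_divS_lt 1 d20.
  have e40 : 0 < e0 / 4 by rewrite divr_gt0.
  have [N2 N2P] := eventually_divS_lt ((e + M) * N.+1%:R) e40.
  have key n : (maxn N1 N2 <= n)%N -> rnorm (grid_sum F n t -
      \sum_(i < N.+1) (t / N.+1%:R)%:C *: F (i%:R * (t / N.+1%:R))) < e0 / 2.
    rewrite geq_max => /andP[N1n N2n].
    have := @rnorm_uniform_sum F (grid_sum F n) e (d / 2) ((e + M) / n.+1%:R) t N t0
      (tN _ (leqnn _)).
    rewrite grid0 subr0 => /(_ _)/le_lt_trans; apply; last first.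
      have -> : (e + M) / n.+1%:R *+ N.+1 = (e + M) * N.+1%:R / n.+1%:R.
        by rewrite -mulr_natr mulrAC.
      have := N2P _ N2n; set y := _ / _; clearbody y; clear -et; lra.
    move=> p q p0 pq pqd; apply: (grid_sum_increment Fd) => //; first exact: ltW.
    by have := N1P _ N1n; rewrite mul1r.
  exists (maxn N1 N2) => n Nn; set S := \sum_(i < _) _ in key.
  rewrite -(subrKA S); apply: le_lt_trans (rnormD _ _) _.
  have := key _ (leqnn _); have := key _ Nn; rewrite [rnorm (S - _)]rnormB; lra.
exists (fun t => lim (grid_sum F n t @[n --> \oo])); last first.
  by rewrite (_ : (fun n => _) = cst 0) ?lim_cst//; apply/funext => n; rewrite grid0.
move=> e e0; have [d d0 Fd] := Fu _ e0.
have d20 : 0 < d / 2 by rewrite divr_gt0.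
exists (d / 2) => // p x q p0 px xq pqd.
have q0 : 0 <= q by apply: le_trans p0 (le_trans px xq).
(* The grid sums satisfy the estimate up to a vanishing error: pass to the limit. *)
apply/ler_addgt0Pr => c c0; have c30 : 0 < c / 3 by rewrite divr_gt0.
have /cvg_rnormP/(_ _ c30) [N1 _ N1P] := Fcvg _ p0.
have /cvg_rnormP/(_ _ c30) [N2 _ N2P] := Fcvg _ q0.
have [N3 N3P] := eventually_divS_lt (e + M) c30.
have [N4 N4P] := eventually_divS_lt 1 d20.
pose n := maxn (maxn N1 N2) (maxn N3 N4).
have := N1P n; have := N2P n; have := N3P n; have := N4P n.
rewrite /n/= !leq_max !leqnn !orbT/= -/n => /(_ isT) h4 /(_ isT) h3 /(_ isT) h2 /(_ isT) h1.
have h : rnorm (grid_sum F n q - grid_sum F n p - (q - p)%:C *: F x)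
    <= e * (q - p) + (e + M) / n.+1%:R.
  by apply: (grid_sum_increment Fd) => //; [exact: ltW | rewrite -div1r].
set Gq := lim _ in h2 *; set Gp := lim _ in h1 *.
have -> : Gq - Gp - (q - p)%:C *: F x = (Gq - grid_sum F n q)
   + (grid_sum F n q - grid_sum F n p - (q - p)%:C *: F x) + - (Gp - grid_sum F n p).
  by rewrite addrA subrKA opprB [RHS]addrAC subrKA.
have := rnormD (Gq - grid_sum F n q + (grid_sum F n q - grid_sum F n p - (q - p)%:C *: F x))
  (- (Gp - grid_sum F n p)).
have := rnormD (Gq - grid_sum F n q)
  (grid_sum F n q - grid_sum F n p - (q - p)%:C *: F x).
rewrite rnormN; move: h h3; set y := (e + M) / _; clearbody y.
clear -h1 h2; lra.
Qed.

End ExistenceOfPrimitive.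

(** * Riemann integrals from primitives *)

Section RiemannOfPrimitive.
Local Open Scope complex_scope.
Context {R : realType} {H : completeNormedModType R[i]}.
Implicit Types (F G : R -> H) (d e M p q x y t s : R).

(** Besides giving uniqueness of primitives, this reduces norm estimates
for the integral to estimates for finite sums of the [U t h]. *)
Lemma uniform_sums_cvg F G t : primitive F G -> G 0 = 0 -> 0 <= t ->
  \sum_(i < n.+1) (t / n.+1%:R)%:C *: F (i%:R * (t / n.+1%:R)) @[n --> \oo] --> G t.
Proof.
move=> FG G0 t0; apply/cvg_rnormP => e e0.
pose e' := e / (t + 1).
have t1 : 0 < t + 1 by rewrite ltr_wpDl.
have e'0 : 0 < e' by rewrite divr_gt0.
have e't : e' * t < e by rewrite -ltr_pdivlMl// /e' invf_div divfK ?gt_eqF// ltrDl.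
have [d d0 Gd] := FG _ e'0.
have [N NP] := eventually_divS_lt t d0.
exists N => // n /= Nn; apply: le_lt_trans e't.
have := @rnorm_uniform_sum _ _ F G e' d 0 t n t0 (NP _ Nn).
rewrite G0 subr0 mul0rn addr0; apply => p q p0 pq pqd.
by rewrite addr0; exact: Gd.
Qed.

Lemma primitive_unique F G G' t : primitive F G -> primitive F G' ->
  G 0 = 0 -> G' 0 = 0 -> 0 <= t -> G t = G' t.
Proof.
move=> FG FG' G0 G'0 t0.
exact: cvg_unique (uniform_sums_cvg FG G0 t0) (uniform_sums_cvg FG' G'0 t0).
Qed.

Lemma primitive_addcst F G (c : H) : primitive F G ->
  primitive (fun x => F x + c) (fun x => G x + x%:C *: c).
Proof.
move=> FG e /FG[d d0 Gd]; exists d => // p x q p0 px xq pqd.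
have := Gd _ _ _ p0 px xq pqd; congr (rnorm _ <= _).
have -> : G q + q%:C *: c - (G p + p%:C *: c) = G q - G p + (q - p)%:C *: c.
  by rewrite opprD addrACA -scalerBl -rmorphB.
by rewrite scalerDr opprD addrACA subrr addr0.
Qed.

Lemma primitive_isometry F G (T : {linear H -> H}) :
  (forall f, rnorm (T f) = rnorm f) -> primitive F G -> primitive (T \o F) (T \o G).
Proof.
move=> isoT FG e /FG[d d0 Gd]; exists d => // p x q p0 px xq pqd.
by rewrite /= -linearZ -!linearB isoT; exact: Gd.
Qed.

Lemma node_mono s t (l : seq R) : itv_partition s t l ->
  forall i, (i < size l)%N -> node s l i <= node s l i.+1.
Proof.
by move=> [/(pathP s) sl _] i il; rewrite /node ltW// sl.
Qed.

Lemma node_ge s t (l : seq R) : itv_partition s t l ->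
  forall i, (i <= size l)%N -> s <= node s l i.
Proof.
move=> sl; elim=> [//|i ih] il.
by apply: le_trans (ih (ltnW il)) _; exact: node_mono sl _ il.
Qed.

Lemma primitive_is_RInt F G s t :
  primitive (fun x => F (s + x)) G -> is_RInt F s t (G (t - s) - G 0).
Proof.
move=> FG e e0.
have e'0 : 0 < e / (`|t - s| + 1) by rewrite divr_gt0// ltr_wpDl.
have [d d0 Gd] := FG _ e'0; exists d => // l xi sl xil meshl.
have [_ /eqP lt] := sl.
have nodeN : node s l (size l) = t by rewrite /node nth_last.
rewrite rnormB.
have := @rnorm_telescope _ _ (fun i => G (node s l i - s))
  (fun i => (node s l i.+1 - node s l i)%:C *: F (xi i))
  (fun i => e / (`|t - s| + 1) * (node s l i.+1 - node s l i)) (size l).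
rewrite nodeN subrr => /(_ _)/le_lt_trans; apply.
  move=> i il; have /andP[nx xn] := xil _ il.
  have := Gd (node s l i - s) (xi i - s) (node s l i.+1 - s).
  rewrite [s + _]addrC subrK.
  have -> : node s l i.+1 - s - (node s l i - s) = node s l i.+1 - node s l i by ring.
  by apply; rewrite ?subr_ge0 ?lerD2r ?(node_ge sl) ?meshl// ltnW.
rewrite -mulr_sumr -(big_mkord xpredT (fun i => node s l i.+1 - node s l i)).
rewrite telescope_sumr// nodeN /= mulrAC ltr_pdivrMr ?ltr_wpDl//.
by rewrite ltr_pM2l// (le_lt_trans (ler_norm _))// ltrDl.
Qed.

Definition uniform_nodes s t n : seq R :=
  [seq s + i.+1%:R * ((t - s) / n.+1%:R) | i <- iota 0 n.+1].

Lemma node_uniform s t n i : (i <= n.+1)%N ->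
  node s (uniform_nodes s t n) i = s + i%:R * ((t - s) / n.+1%:R).
Proof.
case: i => [_|i ilt]; first by rewrite /node/= mul0r addr0.
by rewrite /node /= -/(uniform_nodes s t n) /uniform_nodes (nth_map 0) ?size_iota// nth_iota.
Qed.

Lemma uniform_nodes_partition s t n : s < t ->
  itv_partition s t (uniform_nodes s t n).
Proof.
move=> st; have sz : size (uniform_nodes s t n) = n.+1 by rewrite size_map size_iota.
split.
  apply/(pathP s) => i; rewrite sz => ilt.
  have : node s (uniform_nodes s t n) i < node s (uniform_nodes s t n) i.+1; last by [].
  rewrite (node_uniform s t (ltnW ilt)) (node_uniform s t ilt) ltrD2l.
  by rewrite ltr_pM2r ?ltr_nat// divr_gt0// ?subr_gt0// ltr0n.
rewrite -nth_last sz.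
have -> : nth s (uniform_nodes s t n) n = node s (uniform_nodes s t n) n.+1 by [].
rewrite (node_uniform s t (leqnn n.+1)).
by rewrite mulrC divfK ?pnatr_eq0// addrC subrK.
Qed.

(** The uniform partitions provide tagged partitions of arbitrarily small mesh,
without which the condition defining [is_RInt] could be vacuous. *)
Lemma is_RInt_unique F s t (v w : H) : s < t ->
  is_RInt F s t v -> is_RInt F s t w -> v = w.
Proof.
move=> st Fv Fw; apply: rnorm_small_eq => e e0.
have e20 : 0 < e / 2 by rewrite divr_gt0.
have [d1 d10 F1] := Fv _ e20; have [d2 d20 F2] := Fw _ e20.
have d0 : 0 < Num.min d1 d2 by rewrite lt_min d10.
have [n /(_ n (leqnn _)) nd] := eventually_divS_lt (t - s) d0.
pose l := uniform_nodes s t n.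
have sl : itv_partition s t l by exact: uniform_nodes_partition.
have sz : size l = n.+1 by rewrite size_map size_iota.
have tags i : (i < size l)%N -> node s l i <= node s l i <= node s l i.+1.
  by move=> il; rewrite lexx (node_mono sl).
have mesh i : (i < size l)%N -> node s l i.+1 - node s l i = (t - s) / n.+1%:R.
  by rewrite sz => il; rewrite !node_uniform// ?(ltnW il)// -natr1; ring.
move: nd; rewrite lt_min => /andP[nd1 nd2].
have h1 : rnorm (riemann_sum F s l (node s l) - v) < e / 2.
  by apply: F1 => // i il; rewrite mesh.
have h2 : rnorm (riemann_sum F s l (node s l) - w) < e / 2.
  by apply: F2 => // i il; rewrite mesh.
rewrite -(subrKA (riemann_sum F s l (node s l))).
apply: le_trans (rnormD _ _) _; rewrite rnormB; lra.
Qed.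

Lemma primitive_RInt F G s t : s < t ->
  primitive (fun x => F (s + x)) G -> RInt F s t = G (t - s) - G 0.
Proof.
move=> st /(@primitive_is_RInt _ _ s t) FG; apply: xget_unique => // v Fv.
exact: is_RInt_unique st Fv FG.
Qed.

End RiemannOfPrimitive.

(** * Orbits of the unitary group *)

Section Orbits.
Local Open Scope complex_scope.
Context {R : realType} {H : completeNormedModType R[i]}.
Variables (ip : innerProduct H) (U : R -> {linear H -> H}).
Hypothesis hU : unitary_group ip U.
Implicit Types (f g h : H) (G : R -> H) (e s t x : R).

Lemma rnorm_sqr f : rnorm f ^+ 2 = complex.Re (ip f f).
Proof. by rewrite -dot_norm -rnormE -rmorphXn. Qed.

Lemma rnormU t f : rnorm (U t f) = rnorm f.
Proof.
apply/eqP; rewrite -(eqrXn2 (ltn0Sn 1)) ?rnorm_ge0// !rnorm_sqr.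
by rewrite (ug_unitary hU t).1.
Qed.

Lemma parallelogram f g :
  rnorm (f + g) ^+ 2 + rnorm (f - g) ^+ 2 = 2 * (rnorm f ^+ 2 + rnorm g ^+ 2).
Proof.
rewrite !rnorm_sqr !linearDl !linearDr !linearNl !linearNr !raddfD/= !raddfN/=; ring.
Qed.

Lemma orbit_modulus f e : 0 < e ->
  exists2 d, 0 < d & forall x, `|x| < d -> rnorm (U x f - f) <= e.
Proof.
move=> e0; have /cvg_rnormP/(_ _ e0) := @ug_continuous _ _ _ _ hU f 0.
rewrite (ug0 hU) => /nbhs_ballP[d /= d0 Ud]; exists d => // x xd.
by rewrite rnormB ltW//; apply: Ud; rewrite /ball/= sub0r normrN.
Qed.

(** Since [U y] is isometric, [U x f - U y f] has the norm of [U (x - y) f - f], so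
continuity at 0 is uniform. *)
Lemma orbit_uniformly_continuous f : uniformly_continuous (fun x => U x f).
Proof.
move=> e /(orbit_modulus f)[d d0 Ud]; exists d => // x y xyd.
have -> : U x f = U y (U (x - y) f) by rewrite -(ugD hU) addrC subrK.
by rewrite -linearB rnormU; exact: Ud.
Qed.

Lemma orbit_primitive f : exists2 G, primitive (fun x => U x f) G & G 0 = 0.
Proof.
apply: (@exists_primitive _ _ _ (rnorm f)) => [|x]; first exact: orbit_uniformly_continuous.
by rewrite rnormU.
Qed.

Lemma orbit_shift_primitive f G s : primitive (fun x => U x f) G ->
  primitive (fun x => U (s + x) f) (fun x => U s (G x)).
Proof.
move=> /(primitive_isometry (rnormU s)); congr (primitive _ _).
by apply/funext => x; rewrite /= (ugD hU).
Qed.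

Lemma RInt_orbit f G s t : s < t -> primitive (fun x => U x f) G -> G 0 = 0 ->
  RInt (fun x => U x f) s t = U s (G (t - s)).
Proof.
move=> st /(orbit_shift_primitive s) FG G0.
by rewrite (@primitive_RInt _ _ (fun x => U x f) _ _ _ st FG) G0 linear0 subr0.
Qed.

(** Both sides, as functions of [t], are primitives of the shifted orbit once
[G s] is subtracted. *)
Lemma primitive_cocycle f G s t : primitive (fun x => U x f) G -> G 0 = 0 ->
  0 <= s -> 0 <= t -> G (s + t) = G s + U s (G t).
Proof.
move=> FG G0 s0 t0; suff <- : G (s + t) - G s = U s (G t) by rewrite [RHS]addrC subrK.
apply: (@primitive_unique _ _ (fun x => U (s + x) f) (fun x => G (s + x) - G s)
  (fun x => U s (G x))) => //; last by rewrite G0 linear0.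
- move=> e /FG[d d0 Gd]; exists d => // p x q p0 px xq pqd.
  have -> : G (s + q) - G s - (G (s + p) - G s) = G (s + q) - G (s + p).
    by rewrite opprB addrA subrK.
  have <- : s + q - (s + p) = q - p by ring.
  apply: Gd; rewrite ?lerD2l// ?addr_ge0//.
  by have -> : s + q - (s + p) = q - p by ring.
- exact: orbit_shift_primitive.
- by rewrite addr0 subrr.
Qed.

(** On the fixed part [g] of [f] the average is the identity; what remains is
the integral of the orbit of [f - g]. *)
Lemma time_avg_fixed f g G s t : s < t -> fixed_vectors U g ->
    primitive (fun x => U x (f - g)) G -> G 0 = 0 ->
  time_avg U t s f - g = ((t - s)^-1)%:C *: U s (G (t - s)).
Proof.
move=> st gfix FG G0; rewrite /time_avg.
have Ff : primitive (fun x => U x f) (fun x => G x + x%:C *: g).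
  have := primitive_addcst g FG; congr (primitive _ _); apply/funext => x.
  by rewrite linearB (gfix x) subrK.
rewrite (RInt_orbit st Ff) ?G0 ?scale0r ?addr0//.
rewrite linearD linearZ (gfix s) scalerDr scalerA -rmorphM mulVf ?scale1r ?addrK//.
by rewrite subr_eq0 gt_eqF.
Qed.

Lemma rnorm_i g : rnorm ('i *: g) = rnorm g.
Proof. by rewrite rnormZ normc_def/= expr0n expr1n add0r sqrtr1 mul1r. Qed.

(** The function [t |-> U t g] has derivative [U t ('i *: h)]; the isometry of
[U p] transfers the difference quotient at 0 to every interval [[p, q]]. *)
Lemma generator_primitive g h : generator_graph U g h ->
  primitive (fun x => U x h) (fun x => - 'i *: (U x g - g)).
Proof.
move=> gh e e0; have e20 : 0 < e / 2 by rewrite divr_gt0.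
have [d1 d10 U1] := orbit_modulus h e20.
move/cvg_rnormP/(_ _ e20) : gh => /nbhs_ballP[d2 /= d20 U2].
exists (Num.min d1 d2); first by rewrite lt_min d10.
move=> p x q p0 px xq; rewrite lt_min => /andP[pq1 pq2].
have [->|pq] := eqVneq p q.
  by rewrite !subrr scale0r subr0 rnorm0 mulr0.
have qp : 0 < q - p by rewrite subr_gt0 lt_neqAle pq (le_trans px).
have -> : - 'i *: (U q g - g) - - 'i *: (U p g - g) - (q - p)%:C *: U x h =
    (q - p)%:C *: U p (((0 +i* (q - p))^-1 *: (U (q - p) g - g) - h) - (U (x - p) h - h)).
  set c := (0 +i* (q - p))^-1.
  have -> : c *: (U (q - p) g - g) - h - (U (x - p) h - h) =
      c *: (U (q - p) g - g) - U (x - p) h by rewrite opprB addrA subrK.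
  have pE r k : U p (U (r - p) k) = U r k by rewrite -(ugD hU) addrC subrK.
  rewrite (linearB (U p)) (linearZ_LR (U p)) /= (linearB (U p)) !pE.
  rewrite -scalerBr [RHS]scalerBr scalerA.
  have -> : U q g - g - (U p g - g) = U q g - U p g by rewrite opprB addrA subrK.
  suff -> : (q - p)%:C * c = - 'i by [].
  have c0 : 0 +i* (q - p) != 0 by rewrite eq_complex/= negb_and [_ - _ == 0]gt_eqF ?orbT.
  apply: (mulIf c0); rewrite mulfVK//.
  by apply/eqP; rewrite eq_complex/=; apply/andP; split; apply/eqP; ring.
rewrite rnormZr gtr0_norm// mulrC ler_pM2r// rnormU.
have h1 : rnorm (U (x - p) h - h) <= e / 2.
  by apply: U1; rewrite ger0_norm ?subr_ge0//; apply: le_lt_trans pq1; rewrite lerD2r.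
have h2 : rnorm (h - (0 +i* (q - p))^-1 *: (U (q - p) g - g)) < e / 2.
  by apply: U2; rewrite ?gt_eqF// /ball/= sub0r normrN gtr0_norm.
apply: le_trans (rnormD _ _) _; rewrite rnormN.
by rewrite rnormB; clear -h1 h2; lra.
Qed.

(** The quotient [G y / y] tends to [h] as [y] decreases to 0; for negative
times [U x g - g = - U x (G (- x))], and the isometry [U x] leads back to a
positive time. *)
Lemma primitive_generator g h G : primitive (fun x => U x h) G -> G 0 = 0 ->
  (forall t, 0 < t -> U t g - g = G t) -> generator_graph U ('i *: g) h.
Proof.
move=> FG G0 gG; apply/cvg_rnormP => e e0.
have e20 : 0 < e / 2 by rewrite divr_gt0.
have [d d0 Gd] := FG _ e20.
apply/nbhs_ballP; exists d => //= x; rewrite /ball/= sub0r normrN => xd x0.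
have -> : (0 +i* x)^-1 *: (U x ('i *: g) - 'i *: g) = (x^-1)%:C *: (U x g - g).
  rewrite linearZ -scalerBr scalerA; congr (_ *: _).
  have c0 : 0 +i* x != 0 by rewrite eq_complex/= negb_and x0 orbT.
  apply: (mulIf c0); rewrite mulrAC mulVf// mul1r.
  by apply/eqP; rewrite eq_complex/=; apply/andP; split; apply/eqP; field.
have quot y z : 0 < y -> y < d -> 0 <= z <= y ->
    rnorm (U z h - (y^-1)%:C *: G y) < e.
  move=> y0 yd /andP[z0 zy].
  have := Gd 0 z y (lexx 0) z0 zy; rewrite G0 !subr0 => /(_ yd) le_e.
  have -> : U z h - (y^-1)%:C *: G y = - ((y^-1)%:C *: (G y - y%:C *: U z h)).
    by rewrite scalerBr scalerA -rmorphM mulVf ?gt_eqF// scale1r opprB.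
  rewrite rnormN rnormZr gtr0_norm ?invr_gt0// ltr_pdivrMl//.
  by apply: le_lt_trans le_e _; rewrite mulrC ltr_pM2l// ltr_pdivrMr// ltr_pMr// ltr1n.
have [xpos|xneg|/eqP] := ltgtP 0 x; last by rewrite eq_sym (negPf x0).
  rewrite gG// -[X in X - _](ug0 hU); apply: quot => //; rewrite ?lexx ?ltW//.
  exact: le_lt_trans (ler_norm x) xd.
have nx0 : 0 < - x by rewrite oppr_gt0.
have -> : U x g - g = - U x (G (- x)).
  by rewrite -gG// linearB/= -(ugD hU) subrr (ug0 hU) opprB.
have -> : h - (x^-1)%:C *: - U x (G (- x)) = U x (U (- x) h - ((- x)^-1)%:C *: G (- x)).
  rewrite (linearB (U x)) (linearZ_LR (U x))/= -(ugD hU) subrr (ug0 hU).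
  by rewrite invrN rmorphN scaleNr scalerN.
rewrite rnormU; apply: quot => //; last by rewrite lexx ltW.
by apply: le_lt_trans xd; rewrite -normrN ler_norm.
Qed.

End Orbits.

(** * Bounded cocycles are coboundaries *)

Section BoundedCoboundary.
Local Open Scope complex_scope.
Context {R : realType} {H : completeNormedModType R[i]}.
Variables (ip : innerProduct H) (U : R -> {linear H -> H}).
Hypothesis hU : unitary_group ip U.
Implicit Types (f g h : H) (e s t c : R).
Variables (G : R -> H) (M : R).
Hypothesis cocycle : forall s t, 0 <= s -> 0 <= t -> G (s + t) = G s + U s (G t).
Hypothesis GM : forall t, 0 < t -> rnorm (G t) <= M.

(** The infimum [m] of the [c] admitting such an [x] is the squared asymptotic
radius of the path [- G]; the fixed point is its asymptotic centre. *)
Let eventual_bound (x : H) c :=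
  exists t0, forall t, 0 < t -> t0 <= t -> rnorm (x + G t) ^+ 2 <= c.

Let bounds : set R := [set c | exists x, eventual_bound x c].
Let m := inf bounds.

Let bounds_has_inf : has_inf bounds.
Proof.
split; last first.
  exists 0 => c [x [t0 xc]].
  have := xc (Num.max 1 t0); rewrite lt_max ltr01 le_max lexx orbT => /(_ isT isT).
  by apply: le_trans; rewrite sqr_ge0.
exists (M ^+ 2), 0, 0 => t t0 _; rewrite add0r lerXn2r ?nnegrE ?rnorm_ge0 ?GM//.
by apply: le_trans (GM t0); exact: rnorm_ge0.
Qed.

(** By the parallelogram identity the midpoint of [x] and [y] is eventually
bounded by [c - rnorm (x - y) ^+ 2 / 4], which cannot be less than [m]. *)
Let bounds_close x y c : eventual_bound x c -> eventual_bound y c ->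
  rnorm (x - y) ^+ 2 <= 4 * (c - m).
Proof.
move=> [t1 xc] [t2 yc].
have : m <= c - rnorm (x - y) ^+ 2 / 4.
  apply: ge_inf; first exact: bounds_has_inf.2.
  exists ((2^-1)%:C *: (x + y)), (Num.max t1 t2) => t t0; rewrite ge_max => /andP[t1t t2t].
  have := parallelogram ip (x + G t) (y + G t).
  have -> : x + G t + (y + G t) = 2%:C *: ((2^-1)%:C *: (x + y) + G t).
    by rewrite scalerDr scalerA -rmorphM divff// scale1r addrACA rmorph_nat scaler_nat mulr2n.
  have -> : x + G t - (y + G t) = x - y by rewrite opprD addrACA subrr addr0.
  rewrite rnormZr gtr0_norm// exprMn.
  have := xc _ t0 t1t; have := yc _ t0 t2t; lra.
lra.
Qed.

(** The affine isometry [x |-> U e x - G e] maps [- G t] to [- G (t + e)], so it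
only shifts time and preserves eventual bounds. *)
Let eventual_bound_shift x c e : 0 < e -> eventual_bound x c ->
  eventual_bound (U e x - G e) c.
Proof.
move=> e0 [t0 xc]; exists (Num.max (t0 + e) (e + e)) => t t_gt0.
rewrite ge_max -!lerBrDr => /andP[t0t et].
have -> : G t = G e + U e (G (t - e)).
  by rewrite -cocycle ?ltW// ?(lt_le_trans e0)// addrC subrK.
rewrite addrA subrK -linearD (rnormU hU); apply: xc => //.
exact: lt_le_trans et.
Qed.

(** A minimising sequence for [m] is Cauchy by [bounds_close].  Its images under
[x |-> U t x - G t] are minimising as well, hence ever closer to it, so its
limit is fixed by these maps. *)
Lemma bounded_cocycle_coboundary : exists g, forall t, 0 < t -> U t g - g = G t.
Proof.
have xP n : exists x, eventual_bound x (m + n.+1%:R^-1).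
  have [|c [x xc] cm] := @inf_adherent _ bounds n.+1%:R^-1 _ bounds_has_inf.
    by rewrite invr_gt0.
  exists x; have [t0 xt0] := xc; exists t0 => t t_gt0 t0t.
  exact: le_trans (xt0 t t_gt0 t0t) (ltW cm).
have weaken x c c' : c <= c' -> eventual_bound x c -> eventual_bound x c'.
  by move=> cc' [t0 xc]; exists t0 => t t1 t2; exact: le_trans (xc _ t1 t2) cc'.
pose x n := projT1 (cid (xP n)).
have xb n : eventual_bound (x n) (m + n.+1%:R^-1) by rewrite /x; case: cid.
have small e : 0 < e -> exists N, forall n, (N <= n)%N -> forall y z,
    eventual_bound y (m + n.+1%:R^-1) -> eventual_bound z (m + n.+1%:R^-1) ->
    rnorm (y - z) < e.
  move=> e0; have e20 : 0 < e ^+ 2 / 4 by rewrite divr_gt0// exprn_gt0.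
  have [N NP] := eventually_divS_lt 1 e20.
  exists N => n Nn y z yb zb; rewrite -(ltr_pXn2r (ltn0Sn 1)) ?nnegrE ?rnorm_ge0 ?ltW//.
  apply: le_lt_trans (bounds_close yb zb) _.
  by rewrite addrAC subrr add0r mulrC -ltr_pdivlMr// -div1r NP.
have [g xg] : exists g : H, x @ \oo --> g.
  apply: rnorm_cauchy_cvg => e /small[N NP]; exists N => n Nn.
  apply: (NP N) => //; apply: weaken (xb n).
  by rewrite lerD2l lef_pV2 ?posrE ?ltr0n// ler_nat.
exists g => t t0; apply: rnorm_small_eq => e e0.
have e30 : 0 < e / 3 by rewrite divr_gt0.
have [N1 N1P] := small _ e30.
have /cvg_rnormP/(_ _ e30)[N2 _ N2P] := xg.
pose n := maxn N1 N2.
have h1 := N2P n (leq_maxr _ _).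
have h2 := N1P n (leq_maxl _ _) _ _ (eventual_bound_shift t0 (xb n)) (xb n).
have h3 : rnorm (U t (g - x n)) < e / 3 by rewrite (rnormU hU).
have -> : U t g - g - G t = U t (g - x n) + (U t (x n) - G t - x n) + - (g - x n).
  rewrite (linearB (U t)) opprB -(addrA (U t (x n))) -opprD subrKA opprD.
  by rewrite -[RHS]addrA subrKA [RHS]addrA [RHS]addrAC.
have := rnormD (U t (g - x n) + (U t (x n) - G t - x n)) (- (g - x n)).
have := rnormD (U t (g - x n)) (U t (x n) - G t - x n).
rewrite rnormN; lra.
Qed.

End BoundedCoboundary.

(** * Integrals of bounded functions against a finite measure *)

Section FiniteMeasure.
Context {R : realType} (mu : {measure set (measurableTypeR R) -> \bar R}).
Hypothesis mufin : (mu setT < +oo)%E.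
Implicit Types (f g : R -> R).

Definition bounded_measurable (f : R -> R) :=
  measurable_fun [set: R] f /\ exists M, forall x, `|f x| <= M.

Lemma bounded_measurable_integrable f :
  bounded_measurable f -> mu.-integrable setT (EFin \o f).
Proof.
move=> [mf [M fM]]; apply: measurable_bounded_integrable => //.
by exists M; split; [exact: num_real|move=> x Mx y _; exact: le_trans (fM y) (ltW Mx)].
Qed.

Lemma bounded_measurableD f g : bounded_measurable f -> bounded_measurable g ->
  bounded_measurable (fun x => f x + g x).
Proof.
move=> [mf [M fM]] [mg [N gN]]; split; first exact: measurable_funD.
by exists (M + N) => x; apply: le_trans (ler_normD _ _) _; exact: lerD.
Qed.

Lemma bounded_measurableZ c f : bounded_measurable f ->
  bounded_measurable (fun x => c * f x).
Proof.
move=> [mf [M fM]]; split; first exact: measurable_funM.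
by exists (`|c| * M) => x; rewrite normrM ler_wpM2l.
Qed.

Lemma bounded_measurable_sum n (F : nat -> R -> R) :
  (forall i, bounded_measurable (F i)) ->
  bounded_measurable (fun x => \sum_(i < n) F i x).
Proof.
move=> bF; elim: n => [|n ih].
  rewrite (_ : (fun _ => _) = cst 0); last by apply/funext => x; rewrite big_ord0.
  by split => //; exists 0 => x; rewrite normr0.
under eq_fun do rewrite big_ord_recr/=; exact: bounded_measurableD.
Qed.

Lemma bounded_measurable_indic A : measurable (A : set (measurableTypeR R)) ->
  bounded_measurable (\1_A).
Proof.
move=> mA; split; first exact: measurable_indic.
by exists 1 => x; rewrite indicE; case: (_ \in _); rewrite ?normr1 ?normr0.
Qed.

Lemma bounded_measurable_cos t : bounded_measurable (fun x => cos (t * x)).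
Proof.
split; last by exists 1 => x; exact: cos_max.
apply: continuous_measurable_fun => x.
by apply: (@continuous_comp _ _ _ ( *%R t) cos); [exact: mulrl_continuous|exact: continuous_cos].
Qed.

Lemma bounded_measurable_sin t : bounded_measurable (fun x => sin (t * x)).
Proof.
split; last by exists 1 => x; exact: sin_max.
apply: continuous_measurable_fun => x.
by apply: (@continuous_comp _ _ _ ( *%R t) sin); [exact: mulrl_continuous|exact: continuous_sin].
Qed.

Lemma Rintegral_sum n (F : nat -> R -> R) : (forall i, bounded_measurable (F i)) ->
  Rintegral mu setT (fun x => \sum_(i < n) F i x) =
  \sum_(i < n) Rintegral mu setT (F i).
Proof.
move=> bF; elim: n => [|n ih].
  rewrite big_ord0 (_ : (fun _ => _) = cst 0); last by apply/funext => x; rewrite big_ord0.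
  by rewrite Rintegral_cst// mul0r.
under eq_Rintegral do rewrite big_ord_recr/=.
rewrite RintegralD// ?ih ?big_ord_recr//; apply: bounded_measurable_integrable => //.
exact: bounded_measurable_sum.
Qed.

Lemma Rintegral_indicator A : measurable (A : set (measurableTypeR R)) ->
  Rintegral mu setT \1_A = fine (mu A).
Proof. by move=> mA; rewrite /Rintegral integral_indic// setIT. Qed.

(** Both parts of [f] are scaled by the nonnegative case; their integrals must be
finite for the difference to be distributed over. *)
Lemma Rintegral_mscale (k : {nonneg R}) f : bounded_measurable f ->
  Rintegral (mscale k mu) setT f = k%:num * Rintegral mu setT f.
Proof.
move=> /[dup] [[mf _]] /bounded_measurable_integrable fi; rewrite /Rintegral.
rewrite integralE ge0_integral_mscale//; last first.
  by apply: measurable_funepos; exact/measurable_EFinP.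
rewrite ge0_integral_mscale//; last first.
  by apply: measurable_funeneg; exact/measurable_EFinP.
have pf := integrable_pos_fin_num measurableT fi.
have nf := integrable_neg_fin_num measurableT fi.
set a := integral _ _ _ in pf *; set b := integral _ _ _ in nf *.
rewrite [in RHS]integralE -/a -/b; clearbody a b.
by case: a b pf nf => [a| |] [b| |]//= _ _; rewrite mulrBr.
Qed.

End FiniteMeasure.

(** * Spectral measures *)

Section Spectral.
Local Open Scope complex_scope.
Context {R : realType} {H : completeNormedModType R[i]} {ip : innerProduct H}.
Variable (E : resolution ip).
Implicit Types (f g h : H) (a b d t l : R) (c : R[i]).

Lemma spectral_measure_itv h a b : a <= b ->
  spectral_measure E h `]a, b]%classic = (spectral_cdf E h b - spectral_cdf E h a)%:E.
Proof.
move=> ab; rewrite /spectral_measure /= /lebesgue_stieltjes_measure.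
rewrite /measure_extension measurable_mu_extE/=; last exact: is_ocitv.
by rewrite wlength_itv_bnd.
Qed.

Lemma spectral_cdf_le h l : spectral_cdf E h l <= rnorm h ^+ 2.
Proof.
have o : ip (E l h) (h - E l h) = 0.
  by rewrite res_sym linearB/= res_idem subrr linear0r.
rewrite spectral_cdfE !(rnorm_sqr ip) -{3 4}(subrK (E l h) h) addrC.
by rewrite (@hnormDd _ _ _ _ ip _ _ o) raddfD/= lerDl -rnorm_sqr sqr_ge0.
Qed.

Lemma spectral_cdf_ge0 h l : 0 <= spectral_cdf E h l.
Proof. by rewrite spectral_cdfE sqr_ge0. Qed.

Lemma spectral_measure_cvg h :
  spectral_measure E h `](- n%:R), n%:R]%classic @[n --> \oo] --> spectral_measure E h setT.
Proof.
rewrite -(bigcup_itvT false false); apply: nondecreasing_cvg_mu => //.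
- exact: bigcup_measurable.
- by move=> m n mn; apply/subsetPset/subset_itv; rewrite leBSide/= ?lerN2 ler_nat.
Qed.

Lemma spectral_measure_finite h : (spectral_measure E h setT < +oo)%E.
Proof.
apply: (@le_lt_trans _ _ (rnorm h ^+ 2)%:E); last by rewrite ltry.
rewrite -(cvg_lim _ (@spectral_measure_cvg h))//; apply: lime_le.
  by apply/cvg_ex; eexists; exact: spectral_measure_cvg.
apply: nearW => n; rewrite spectral_measure_itv ?lee_fin; last first.
  by apply: (@le_trans _ _ 0); rewrite ?oppr_le0 ler0n.
by apply: le_trans (spectral_cdf_le h n%:R); rewrite lerBlDr lerDl spectral_cdf_ge0.
Qed.

Lemma spectral_measure_tail h e : 0 < e -> exists N : nat, forall d, N%:R <= d ->
  fine (spectral_measure E h (~` `](- d), d]%classic)) < e.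
Proof.
move=> e0.
have fin A : measurable A -> spectral_measure E h A \is a fin_num.
  move=> mA; rewrite ge0_fin_numE//; apply: le_lt_trans (spectral_measure_finite h).
  by apply: le_measure; rewrite ?inE.
have : fine (spectral_measure E h `](- n%:R), n%:R]%classic) @[n --> \oo]
    --> fine (spectral_measure E h setT).
  apply: fine_cvg; rewrite fineK; last exact: fin. 
  exact: spectral_measure_cvg.
move=> /cvgrPdist_lt/(_ _ e0)[N _ NP]; exists N => d Nd.
have d0 : 0 <= d by apply: le_trans Nd; rewrite ler0n.
rewrite -setTD measureD//; last exact: spectral_measure_finite.
have mI : measurable (`](- d), d]%classic : set (measurableTypeR R)) by exact: measurable_itv.
rewrite setTI fineB ?fin//.
have := NP N (leqnn N); apply: le_lt_trans; apply: le_trans (ler_norm _).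
rewrite lerB// fine_le ?fin//; apply: le_measure; rewrite ?inE//.
by apply: subset_itv; rewrite leBSide/= ?lerN2.
Qed.

(** The distribution function is quadratic in the vector, and a
Lebesgue-Stieltjes measure is determined by its values on half-open
intervals. *)
Lemma spectral_measure_scale c h (k : {nonneg R}) A : k%:num = complex.Re `|c| ^+ 2 ->
  measurable A ->
  spectral_measure E (c *: h) A = mscale k (spectral_measure E h) A.
Proof.
move=> kc mA; apply: (lebesgue_stieltjes_measure_unique
  (mu := mscale k (spectral_measure E h))) => // X /ocitvP[->|[[a b] /= ab ->]].
  by rewrite !measure0.
rewrite /mscale (spectral_measure_itv _ (ltW ab)).
have sc l : spectral_cdf E (c *: h) l = k%:num * spectral_cdf E h l.
  by rewrite !spectral_cdfE linearZ/= rnormZ exprMn kc.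
by rewrite !sc spectral_measure_itv ?ltW// -EFinM mulrBr.
Qed.

Lemma cintegral_scale c h phi :
    bounded_measurable (fun x => complex.Re (phi x)) ->
    bounded_measurable (fun x => complex.Im (phi x)) ->
  cintegral (spectral_measure E (c *: h)) phi =
  (complex.Re `|c| ^+ 2)%:C * cintegral (spectral_measure E h) phi.
Proof.
move=> bRe bIm; have k0 : 0 <= complex.Re `|c| ^+ 2 by rewrite sqr_ge0.
have scale psi : bounded_measurable psi ->
    Rintegral (spectral_measure E (c *: h)) setT psi =
    complex.Re `|c| ^+ 2 * Rintegral (spectral_measure E h) setT psi.
  move=> /(Rintegral_mscale (spectral_measure_finite h) (NngNum k0)) /= <-.
  congr fine; apply: eq_measure_integral => A mA _.
  exact: spectral_measure_scale.
by rewrite /cintegral !scale//; apply/eqP; rewrite eq_complex/= !mul0r subr0 addr0 !eqxx.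
Qed.

(** On the diagonal the four vectors of the polarisation are
[(1 + 'i ^+ k) *: h], with squared norms 4, 2, 0 and 2 times that of [h]; the terms
with [k = 1] and [k = 3] cancel. *)
Lemma resolution_integral_diag phi h :
    bounded_measurable (fun x => complex.Re (phi x)) ->
    bounded_measurable (fun x => complex.Im (phi x)) ->
  resolution_integral E phi h h = cintegral (spectral_measure E h) phi.
Proof.
move=> bRe bIm; rewrite /resolution_integral.
have hE c : h + c *: h = (1 + c) *: h by rewrite scalerDl scale1r.
have sqr_norm c : complex.Re `|c| ^+ 2 = complex.Re c ^+ 2 + complex.Im c ^+ 2.
  by rewrite normc_def/= sqr_sqrtr// addr_ge0 ?sqr_ge0.
have i2 : (0 +i* 1) ^+ 2 = -1 :> R[i] by rewrite -sqr_i.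
have i3 : (0 +i* 1) ^+ 3 = - (0 +i* 1) :> R[i] by rewrite exprS i2 mulrN1.
under eq_bigr do rewrite hE cintegral_scale// sqr_norm.
set z := cintegral _ _.
rewrite !big_ord_recl big_ord0 /= /bump/= expr0 expr1 i2 i3 /=.
have -> : (1 + 1) ^+ 2 + (0 + 0) ^+ 2 = 4 :> R by ring.
have -> : (1 + 0) ^+ 2 + (0 + 1) ^+ 2 = 2 :> R by ring.
set a := (X in -1 * (X%:C * z)); have -> : a = 0 by rewrite /a; ring.
set b := (X in - 'i * (X%:C * z)); have -> : b = 2 by rewrite /b; ring.
rewrite !rmorph_nat rmorph0.
have : (4 : R[i]) != 0 by rewrite pnatr_eq0.
move=> n4; apply: (mulfI n4); rewrite mulrA divff// mul1r.
by rewrite mul0r mulr0 add0r addr0 mulNr subrr addr0 mul1r.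
Qed.

Variables (U : R -> {linear H -> H}).
Hypothesis hU : unitary_group ip U.
Hypothesis hE : is_spectral_resolution E U.

Lemma Re_dot_orbit h t :
  complex.Re (ip (U t h) h) = Rintegral (spectral_measure E h) setT (fun x => cos (t * x)).
Proof.
rewrite hE resolution_integral_diag//=.
- exact: bounded_measurable_cos.
- exact: bounded_measurable_sin.
Qed.

(** Expanding the square gives a double sum of the inner products
[ip (U (t j - t k) h) h], whose real parts are integrals of cosines; the double sum of
cosines is the squared modulus of the exponential sum. *)
Lemma rnorm_orbit_sum h a (t : nat -> R) n :
  rnorm (\sum_(j < n) a%:C *: U (t j) h) ^+ 2 =
  Rintegral (spectral_measure E h) setT (fun x =>
    a ^+ 2 * ((\sum_(j < n) cos (t j * x)) ^+ 2 + (\sum_(j < n) sin (t j * x)) ^+ 2)).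
Proof.
have fin := spectral_measure_finite h.
have dbl x : (\sum_(j < n) cos (t j * x)) ^+ 2 + (\sum_(j < n) sin (t j * x)) ^+ 2 =
    \sum_(j < n) \sum_(k < n) cos ((t j - t k) * x).
  rewrite !expr2 !big_distrlr/= -big_split/=; apply: eq_bigr => j _.
  by rewrite -big_split/=; apply: eq_bigr => k _; rewrite mulrBl cosB.
under eq_Rintegral do rewrite dbl.
have bcos j k : bounded_measurable (fun x => cos ((t j - t k) * x)).
  exact: bounded_measurable_cos.
have bsum j : bounded_measurable (fun x => \sum_(k < n) cos ((t j - t k) * x)).
  exact: (bounded_measurable_sum n (fun k => bcos j k)).
have bdbl := bounded_measurable_sum n bsum.
rewrite RintegralZl//; last exact: (bounded_measurable_integrable fin bdbl).
rewrite -scaler_sumr rnormZr exprMn real_normK ?num_real//; congr (_ * _).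
rewrite (@Rintegral_sum _ _ fin n (fun j x => \sum_(k < n) cos ((t j - t k) * x)))//.
rewrite (rnorm_sqr ip) linear_sumlz/= raddf_sum; apply: eq_bigr => j _.
rewrite (@Rintegral_sum _ _ fin n (fun k x => cos ((t j - t k) * x)))//.
rewrite linear_sumr raddf_sum; apply: eq_bigr => k _.
rewrite -Re_dot_orbit -(ug_unitary hU (t k)).1 -(ugD hU) addrC subrK.
by [].
Qed.

End Spectral.

(** * The kernel of the averaged orbit *)

Section FejerKernel.
Context {R : realType}.
Implicit Types (x y l T : R).

Lemma sin_mvt y : 0 <= y -> exists2 c, 0 <= c <= y & sin y = cos c * y.
Proof.
move=> y0; have dsin c : c \in `]0, y[ -> is_derive c 1 (@sin R) (cos c).
  by move=> _; exact: is_derive_sin.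
have [|c] := MVT_segment y0 dsin.
  by apply: continuous_subspaceT; exact: continuous_sin.
by rewrite in_itv/= sin0 !subr0 => ? ?; exists c.
Qed.

Lemma sin_sqr_le y : sin y ^+ 2 <= y ^+ 2.
Proof.
wlog y0 : y / 0 <= y.
  move=> le; have [|/ltW] := leP 0 y; first exact: le.
  by rewrite -oppr_ge0 => /le; rewrite sinN !sqrrN.
have [c _ ->] := sin_mvt y0; rewrite exprMn ler_piMl ?sqr_ge0//.
Qed.

Lemma cos_half x : cos x = 1 - 2 * sin (x / 2) ^+ 2.
Proof.
have -> : cos x = cos ((x / 2) *+ 2) by rewrite -mulr_natr divfK.
rewrite cos_mulr2n cos2sin2; ring.
Qed.

Lemma cos_ge_half x : `|x| <= 1 -> 2^-1 <= cos x.
Proof.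
move=> x1; rewrite cos_half; have := sin_sqr_le (x / 2).
have : x ^+ 2 <= 1 by rewrite -real_normK ?num_real// expr_le1.
rewrite expr_div_n; lra.
Qed.

Lemma sin_sqr_ge y : `|y| <= 1 -> y ^+ 2 / 4 <= sin y ^+ 2.
Proof.
wlog y0 : y / 0 <= y.
  move=> le; have [|/ltW] := leP 0 y; first exact: le.
  by rewrite -oppr_ge0 => /le; rewrite sinN normrN !sqrrN.
rewrite ger0_norm// => y1; have [c /andP[c0 cy] ->] := sin_mvt y0.
have := @cos_ge_half c; rewrite ger0_norm// => /(_ (le_trans cy y1)) cc.
rewrite exprMn mulrC ler_wpM2r ?sqr_ge0//; nra.
Qed.

(** Real and imaginary parts of the identity
[(\sum_(j < n) z ^+ j) * (z - 1) = z ^+ n - 1] at [z = exp ('i x)]. *)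
Lemma dirichlet_sum n x :
  (\sum_(j < n) cos (j%:R * x)) * (cos x - 1) - (\sum_(j < n) sin (j%:R * x)) * sin x
    = cos (n%:R * x) - 1 /\
  (\sum_(j < n) cos (j%:R * x)) * sin x + (\sum_(j < n) sin (j%:R * x)) * (cos x - 1)
    = sin (n%:R * x).
Proof.
elim: n => [|n [ihc ihs]]; first by rewrite !big_ord0 !mul0r cos0 sin0 subr0 subrr addr0.
rewrite !big_ord_recr/= -natr1 [(_ + 1) * x]mulrDl mul1r cosD sinD.
by split; [move: ihc|move: ihs] => /eqP; rewrite -subr_eq0 => /eqP e; apply/eqP;
  rewrite -subr_eq0 -[0 in X in _ == X]e; apply/eqP; ring.
Qed.

(** The squared modulus of [\sum_(j < n) exp ('i j x)]. *)
Definition dirichlet_sqr n x :=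
  (\sum_(j < n) cos (j%:R * x)) ^+ 2 + (\sum_(j < n) sin (j%:R * x)) ^+ 2.

(** By [dirichlet_sum] the sum times [2 - 2 * cos x] is [2 - 2 * cos (n * x)], at most
4, whereas [2 - 2 * cos x] is at least [x ^+ 2 / 4] on this range. *)
Lemma dirichlet_sqr_le n x : `|x| <= 1 -> dirichlet_sqr n x * x ^+ 2 <= 16.
Proof.
move=> x1; rewrite /dirichlet_sqr; have [] := dirichlet_sum n x.
set C := \sum_(j < n) _; set S := \sum_(j < n) _ => ec es.
have d0 : 0 <= C ^+ 2 + S ^+ 2 by rewrite addr_ge0 ?sqr_ge0.
have sq : (C ^+ 2 + S ^+ 2) * ((cos x - 1) ^+ 2 + sin x ^+ 2) =
    (cos (n%:R * x) - 1) ^+ 2 + sin (n%:R * x) ^+ 2 by rewrite -ec -es; ring.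
have e1 y : (cos y - 1) ^+ 2 + sin y ^+ 2 = 2 - 2 * cos y.
  by rewrite sin2cos2; ring.
move: sq; rewrite !e1 => sq.
have h1 : x ^+ 2 / 4 <= 2 - 2 * cos x.
  rewrite cos_half; have := @sin_sqr_ge (x / 2).
  rewrite expr_div_n normrM [`|2^-1|]ger0_norm// => /(_ _); 
  have -> : `|x| / 2 <= 1 by lra.
  move=> /(_ isT); lra.
have h2 : 2 - 2 * cos (n%:R * x) <= 4 by have := cos_geN1 (n%:R * x); lra.
have : (C ^+ 2 + S ^+ 2) * (x ^+ 2 / 4) <= 4.
  by apply: le_trans h2; rewrite -sq ler_wpM2l.
rewrite mulrA; lra.
Qed.

Lemma dirichlet_sqr_le_sqr n x : dirichlet_sqr n x <= n%:R ^+ 2.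
Proof.
rewrite /dirichlet_sqr !expr2 !big_distrlr/= -big_split/=.
have -> : n%:R * n%:R = \sum_(j < n) \sum_(k < n) 1 :> R.
  by rewrite !sumr_const card_ord mulr_natr.
apply: ler_sum => j _; rewrite -big_split/=; apply: ler_sum => k _.
by rewrite -cosB cos_le1.
Qed.

Lemma dirichlet_sqr_ge n x : n%:R * `|x| <= 1 -> n%:R ^+ 2 / 4 <= dirichlet_sqr n x.
Proof.
move=> nx; rewrite /dirichlet_sqr.
have : n%:R / 2 <= \sum_(j < n) cos (j%:R * x).
  have -> : n%:R / 2 = \sum_(j < n) 2^-1 :> R by rewrite sumr_const card_ord mulr_natl.
  apply: ler_sum => j _; apply: cos_ge_half; apply: le_trans nx.
  by rewrite normrM ger0_norm// ler_wpM2r// ler_nat ltnW.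
move=> le; have n0 : 0 <= n%:R :> R by [].
have : (n%:R / 2) ^+ 2 <= (\sum_(j < n) cos (j%:R * x)) ^+ 2.
  by rewrite lerXn2r// nnegrE ?divr_ge0// (le_trans _ le) ?divr_ge0.
have := sqr_ge0 (\sum_(j < n) sin (j%:R * x)).
rewrite expr_div_n; lra.
Qed.

(** The squared modulus of the [n]-th uniform Riemann sum of [exp ('i t l)] for [t] in
[[0, T]]; by [rnorm_orbit_sum], it is the spectral density of the squared
norm of the same Riemann sum of an orbit. *)
Definition fejer T n l := (T / n%:R) ^+ 2 *
  ((\sum_(j < n) cos (j%:R * (T / n%:R) * l)) ^+ 2 +
   (\sum_(j < n) sin (j%:R * (T / n%:R) * l)) ^+ 2).

Lemma fejerE T n l : fejer T n l = (T / n%:R) ^+ 2 * dirichlet_sqr n (T / n%:R * l).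
Proof.
have e (f : R -> R) : \sum_(j < n) f (j%:R * (T / n%:R) * l) =
    \sum_(j < n) f (j%:R * (T / n%:R * l)).
  by apply: eq_bigr => j _; rewrite -!mulrA.
by rewrite /fejer !e.
Qed.

Lemma fejer_le_sqr T n l : (0 < n)%N -> fejer T n l <= T ^+ 2.
Proof.
move=> n0; rewrite fejerE.
have -> : T ^+ 2 = (T / n%:R) ^+ 2 * n%:R ^+ 2.
  by rewrite -exprMn divfK// pnatr_eq0 -lt0n.
by rewrite ler_wpM2l ?sqr_ge0// dirichlet_sqr_le_sqr.
Qed.

Lemma fejer_ge T n l : (0 < n)%N -> 0 < T -> `|l| <= T^-1 -> T ^+ 2 / 4 <= fejer T n l.
Proof.
move=> n0 T0 lT; rewrite fejerE.
have nn : n%:R != 0 :> R by rewrite pnatr_eq0 -lt0n.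
have -> : T ^+ 2 / 4 = (T / n%:R) ^+ 2 * (n%:R ^+ 2 / 4).
  by rewrite mulrA -exprMn divfK.
rewrite ler_wpM2l ?sqr_ge0//; apply: dirichlet_sqr_ge.
have -> : n%:R * `|T / n%:R * l| = T * `|l|.
  rewrite normrM (ger0_norm (divr_ge0 (ltW T0) (ler0n _ n))) mulrA; congr (_ * _).
  by rewrite mulrC divfK.
by rewrite mulrC -ler_pdivlMr// div1r.
Qed.

(** Since [fejer T n] is periodic in [l], it can decay like [l ^- 2] only on a range
of [l] that grows with [n]. *)
Lemma fejer_decay T n l : (0 < n)%N -> `|T * l| <= n%:R -> fejer T n l * l ^+ 2 <= 16.
Proof.
move=> n0 Tl; rewrite fejerE mulrAC [X in X <= _]mulrC -exprMn.
apply: dirichlet_sqr_le.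
by rewrite mulrAC normrM normfV [`|n%:R|]ger0_norm// ler_pdivrMr ?ltr0n// mul1r.
Qed.

End FejerKernel.

(** * Time averages and the spectral measure near 0 *)

Section SpectralBounds.
Local Open Scope complex_scope.
Context {R : realType} {H : completeNormedModType R[i]} {ip : innerProduct H}.
Variables (E : resolution ip) (U : R -> {linear H -> H}).
Hypothesis hU : unitary_group ip U.
Hypothesis hE : is_spectral_resolution E U.
Implicit Types (f g h : H) (G : R -> H) (a b d t l T : R).

Lemma cvg_rnorm_sqr (u : nat -> H) (l : H) :
  u @ \oo --> l -> rnorm (u n) ^+ 2 @[n --> \oo] --> rnorm l ^+ 2.
Proof.
move=> ul; have c : rnorm (u n) @[n --> \oo] --> rnorm l.
  apply/cvgrPdist_lt => e e0; move/cvg_rnormP/(_ _ e0) : ul.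
  by apply: filterS => n; apply: le_lt_trans; exact: rnorm_dist.
by rewrite expr2; under eq_fun do rewrite expr2; exact: cvgM.
Qed.

Lemma bounded_measurable_fejer T n : bounded_measurable (fejer T n).
Proof.
have mc : measurable_fun [set: R]
    (fun l => \sum_(j < n) cos (j%:R * (T / n%:R) * l)).
  exact: (bounded_measurable_sum n (fun j => bounded_measurable_cos (j%:R * (T / n%:R)))).1.
have ms : measurable_fun [set: R]
    (fun l => \sum_(j < n) sin (j%:R * (T / n%:R) * l)).
  exact: (bounded_measurable_sum n (fun j => bounded_measurable_sin (j%:R * (T / n%:R)))).1.
split.
  apply: measurable_funM => //.
  by apply: measurable_funD; exact: measurable_funX.
exists (T ^+ 2) => l; rewrite ger0_norm; last first.
  by rewrite /fejer mulr_ge0 ?addr_ge0 ?sqr_ge0.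
have [->|n0] := posnP n; last exact: fejer_le_sqr.
by rewrite /fejer invr0 mulr0 expr0n mul0r sqr_ge0.
Qed.

Lemma rnorm_riemann_sum h T n :
  rnorm (\sum_(i < n) (T / n%:R)%:C *: U (i%:R * (T / n%:R)) h) ^+ 2 =
  Rintegral (spectral_measure E h) setT (fejer T n).
Proof. by rewrite (rnorm_orbit_sum hU hE h _ (fun i => i%:R * (T / n%:R))). Qed.

Lemma sym_itvP d l : `](- d), d]%classic l -> `|l| <= d.
Proof. by rewrite /= in_itv/= => /andP[dl ld]; rewrite ler_norml ld ltW. Qed.

Lemma sym_itvPn d l : ~ `](- d), d]%classic l -> d <= `|l|.
Proof.
move=> /negP; rewrite in_itv/= negb_and -leNgt -ltNge => /orP[l_le|/ltW dl].
  by rewrite -normrN; apply: le_trans (ler_norm _); rewrite lerNr.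
exact: le_trans dl (ler_norm l).
Qed.

(** For [`|l| <= T^-1] the phases [j * T * l / n] stay in [[-1, 1]], where the cosine
is at least [1/2]: the Riemann sums do not oscillate and have modulus at least
[T / 2]. *)
Lemma spectral_measure_le_primitive h G T : primitive (fun x => U x h) G -> G 0 = 0 ->
    0 < T ->
  T ^+ 2 / 4 * fine (spectral_measure E h `](- T^-1), T^-1]%classic) <= rnorm (G T) ^+ 2.
Proof.
move=> hG G0 T0; have fin := spectral_measure_finite E h.
have cv := cvg_rnorm_sqr (uniform_sums_cvg hG G0 (ltW T0)).
rewrite -(cvg_lim _ cv)//; apply: limr_ge; first by apply/cvg_ex; eexists; exact: cv.
apply: nearW => n; rewrite rnorm_riemann_sum.
have mI : measurable (`](- T^-1), T^-1]%classic : set (measurableTypeR R)).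
  exact: measurable_itv.
rewrite -(Rintegral_indicator _ mI) -RintegralZl//; last first.
  by apply: (bounded_measurable_integrable fin); exact: bounded_measurable_indic.
apply: le_Rintegral => //.
- apply: (bounded_measurable_integrable fin); apply: bounded_measurableZ.
  exact: bounded_measurable_indic.
- exact: (bounded_measurable_integrable fin (bounded_measurable_fejer _ _)).
move=> l _; change (T ^+ 2 / 4 * (l \in `](- T^-1), T^-1]%classic)%:R <= fejer T n.+1 l).
have [/set_mem/sym_itvP lI|_] := boolP (l \in _); first by rewrite mulr1 fejer_ge.
by rewrite mulr0 /fejer mulr_ge0 ?addr_ge0 ?sqr_ge0.
Qed.

(** The increasing dyadic neighbourhoods of 0 on which the kernel is estimated. *)
Let I T k : set R := `](- (2 ^+ k / T)), 2 ^+ k / T]%classic.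

(** On [I T 0] the bound is [T ^+ 2]; on [I T k.+1] minus [I T k] it is
[16 / l ^+ 2], at most [T ^+ 2 * 16 / 4 ^+ k]; outside [I T M], where the discrete kernel does not decay,
it is [T ^+ 2] again, and only the smallness of the tail of the measure helps. *)
Lemma fejer_dyadic T n M l : 0 < T -> (2 ^ M <= n)%N ->
  fejer T n l <= T ^+ 2 * (\1_(I T 0) l
    + \sum_(k < M) 16 / 4 ^+ k * \1_(I T k.+1) l + \1_(~` I T M) l).
Proof.
move=> T0 Mn; have n0 : (0 < n)%N by apply: leq_trans Mn; rewrite expn_gt0.
have T20 : 0 < T ^+ 2 by rewrite exprn_gt0.
have ind0 A : 0 <= \1_A l :> R by rewrite indicE.
have term0 k : 0 <= 16 / 4 ^+ k * \1_(I T k.+1) l :> R.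
  by rewrite mulr_ge0// divr_ge0// exprn_ge0.
have sum0 : 0 <= \sum_(k < M) 16 / 4 ^+ k * \1_(I T k.+1) l :> R.
  by apply: sumr_ge0 => k _.
have [lM|lM] := pselect (I T M l); last first.
  apply: le_trans (fejer_le_sqr T l n0) _; rewrite ler_pMr//.
  have -> : \1_(~` I T M) l = 1 :> R by rewrite indicE mem_set.
  by rewrite lerDr addr_ge0.
have /ex_minnP[k lk kmin] : exists k, `[< I T k l >] by exists M; apply/asboolP.
move/asboolP : lk; case: k kmin => [|k] kmin lk.
  apply: le_trans (fejer_le_sqr T l n0) _; rewrite ler_pMr//.
  have -> : \1_(I T 0) l = 1 :> R by rewrite indicE mem_set.
  by rewrite -addrA lerDl addr_ge0.
have kM : (k < M)%N by apply: kmin; apply/asboolP.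
have lkn : 2 ^+ k / T <= `|l|.
  apply: sym_itvPn => lk'; have := kmin k; rewrite ltnn => /(_ _).
  by move=> h; have := h (asboolT lk').
have l0 : 0 < `|l| by apply: lt_le_trans lkn; rewrite divr_gt0// exprn_gt0.
have decay : fejer T n l * l ^+ 2 <= 16.
  apply: fejer_decay => //; rewrite normrM gtr0_norm// mulrC -ler_pdivlMr//.
  apply: le_trans (sym_itvP lM) _; rewrite ler_pM2r ?invr_gt0//.
  by rewrite -natrX ler_nat.
apply: (@le_trans _ _ (T ^+ 2 * (16 / 4 ^+ k))).
  have l20 : 0 < l ^+ 2 by rewrite -real_normK ?num_real// exprn_gt0.
  rewrite -(ler_pM2r l20); apply: le_trans decay _.
  have : (2 ^+ k / T) ^+ 2 <= l ^+ 2.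
    rewrite -[leRHS]real_normK ?num_real// lerXn2r// ?nnegrE ?(ltW l0)//.
    by rewrite divr_ge0 ?(ltW T0)// exprn_ge0.
  rewrite -(ler_pM2l (_ : 0 < T ^+ 2 * (16 / 4 ^+ k))); last first.
    by rewrite mulr_gt0// divr_gt0// exprn_gt0.
  apply: le_trans.
  have e4 : 2 ^+ 2 = 4 :> R by rewrite -natrX.
  rewrite expr_div_n -exprM mulnC exprM e4.
  have k4 : 4 ^+ k != 0 :> R by rewrite expf_neq0.
  have -> : T ^+ 2 * (16 / 4 ^+ k) * (4 ^+ k / T ^+ 2) = 16 :> R.
    by field; rewrite ?k4 ?gt_eqF.
  by [].
rewrite ler_pM2l// (bigD1 (Ordinal kM))//=.
have -> : \1_(I T k.+1) l = 1 :> R by rewrite indicE mem_set.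
set r := \sum_(j < M | _) _.
have r0 : 0 <= r by apply: sumr_ge0 => j _; exact: term0.
by rewrite mulr1 -addrA -addrA [leRHS]addrCA lerDl addrCA !addr_ge0.
Qed.

(** The sum of the series [1 + \sum_k 16 / 4 ^+ k * (2 ^+ k.+1) `^ alpha] that results from
integrating [fejer_dyadic]; it converges because [alpha < 2]. *)
Definition dyadic_constant (alpha : R) : R :=
  1 + 16 * 2 `^ alpha / (1 - 2 `^ alpha / 4).

Lemma geometric_le (q : R) n : 0 <= q < 1 -> \sum_(k < n) q ^+ k <= (1 - q)^-1.
Proof.
move=> /andP[q0 q1]; have d0 : 0 < 1 - q by rewrite subr_gt0.
rewrite -div1r ler_pdivlMr// mulrC.
have -> : (1 - q) * \sum_(k < n) q ^+ k = 1 - q ^+ n.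
  by rewrite -[1 - q]opprB mulNr -subrX1 opprB.
by rewrite lerBlDr lerDl exprn_ge0.
Qed.

Lemma dyadic_ratio (alpha : R) : alpha < 2 -> 0 <= (2 : R) `^ alpha / 4 < 1.
Proof.
move=> a2; rewrite divr_ge0 ?powR_ge0//= ltr_pdivrMr// mul1r.
have -> : 4 = 2 `^ 2 :> R by rewrite (powR_mulrn 2)// -natrX.
by rewrite /powR !pnatr_eq0/= ltr_expR ltr_pM2r// ln_gt0// ltr1n.
Qed.

Lemma fine_spectral_measure_le h (B : set (measurableTypeR R)) a : measurable B ->
  (spectral_measure E h B <= a%:E)%E -> fine (spectral_measure E h B) <= a.
Proof.
move=> mB le; rewrite -lee_fin fineK// ge0_fin_numE//.
exact: le_lt_trans le (ltry _).
Qed.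

Lemma Xbound_ge0 alpha h A : Xbound E alpha h A -> 0 <= A.
Proof.
by move=> /(_ 1 ltr01); rewrite powR1 mulr1 -(lee_fin 0 A); apply: le_trans.
Qed.

(** Integrate [fejer_dyadic], let [n] tend to infinity with [M] fixed, and
choose [M] so large that the tail outside [I T M] is negligible. *)
Lemma primitive_le_Xbound h G alpha A T : primitive (fun x => U x h) G -> G 0 = 0 ->
    alpha < 2 -> Xbound E alpha h A -> 0 < T ->
  rnorm (G T) ^+ 2 <= T ^+ 2 * (dyadic_constant alpha * A * T `^ (- alpha)).
Proof.
move=> hG G0 a2 hA T0; have fin := spectral_measure_finite E h.
have T20 : 0 < T ^+ 2 by rewrite exprn_gt0.
have mI k : measurable (I T k : set (measurableTypeR R)) by exact: measurable_itv.
have mIC k : measurable (~` I T k : set (measurableTypeR R)) by exact: measurableC.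
apply/ler_addgt0Pr => e e0.
have [N Ntail] := spectral_measure_tail E h (divr_gt0 e0 T20).
have [M MN] : exists M, N%:R <= 2 ^+ M / T.
  (* [2 ^ M] exceeds [M], and [M] exceeds [N * T]. *)
  exists (Num.truncn (N%:R * T)).+1; rewrite ler_pdivlMr//.
  have /andP[_ /ltW/le_trans] := truncn_itv (mulr_ge0 (ler0n _ N) (ltW T0)); apply.
  by rewrite -natrX ler_nat ltnW// ltn_expl.
pose bound := T ^+ 2 * (fine (spectral_measure E h (I T 0))
   + \sum_(k < M) 16 / 4 ^+ k * fine (spectral_measure E h (I T k.+1))
   + fine (spectral_measure E h (~` I T M))).
have bI := bounded_measurable_indic.
have bterm k : bounded_measurable (fun l => 16 / 4 ^+ k * \1_(I T k.+1) l : R).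
  by apply: bounded_measurableZ; exact: bI.
have bsum := bounded_measurable_sum M bterm.
have bsum1 := bounded_measurableD (bI _ _ (mI 0)) bsum.
have bsum2 := bounded_measurableD bsum1 (bI _ _ (mIC M)).
have int psi := @bounded_measurable_integrable _ _ fin psi.
have boundE : bound = Rintegral (spectral_measure E h) setT (fun l => T ^+ 2 * (\1_(I T 0) l
    + \sum_(k < M) 16 / 4 ^+ k * \1_(I T k.+1) l + \1_(~` I T M) l)).
  rewrite (RintegralZl _ measurableT (int _ bsum2)).
  rewrite (RintegralD measurableT (int _ bsum1) (int _ (bI _ _ (mIC M)))).
  rewrite (RintegralD measurableT (int _ (bI _ _ (mI 0))) (int _ bsum)).
  rewrite (Rintegral_sum fin M bterm) !Rintegral_indicator//; congr (_ * (_ + _ + _)).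
  apply: eq_bigr => k _.
  by rewrite (RintegralZl _ measurableT (int _ (bI _ _ (mI k.+1)))) Rintegral_indicator.
have le_bound : rnorm (G T) ^+ 2 <= bound.
  have cv := cvg_rnorm_sqr (uniform_sums_cvg hG G0 (ltW T0)).
  rewrite -(cvg_lim _ cv)//; apply: limr_le; first by apply/cvg_ex; eexists; exact: cv.
  exists (2 ^ M)%N => // n /= Mn; rewrite rnorm_riemann_sum boundE.
  apply: le_Rintegral => //.
  - exact: (int _ (bounded_measurable_fejer _ _)).
  - exact: (int _ (bounded_measurableZ _ bsum2)).
  - by move=> l _; apply: fejer_dyadic => //; exact: leqW.
apply: le_trans le_bound _.
set rho := 2 `^ alpha; set S := T `^ (- alpha).
have S0 : 0 <= S by exact: powR_ge0.
have rho0 : 0 <= rho by exact: powR_ge0.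
have A0 := Xbound_ge0 hA.
have sI k : fine (spectral_measure E h (I T k)) <= A * S * rho ^+ k.
  apply: fine_spectral_measure_le => //.
  have := hA (2 ^+ k / T); rewrite divr_gt0 ?exprn_gt0// => /(_ isT).
  rewrite powRM ?invr_ge0 ?exprn_ge0 ?(ltW T0)//.
  have -> : (2 ^+ k) `^ alpha = rho ^+ k.
    by rewrite -powR_mulrn// powRAC powR_mulrn.
  have -> : T^-1 `^ alpha = S by rewrite -powR_inv1 ?(ltW T0)// -powRrM mulN1r.
  by rewrite -mulrA [S * _]mulrC.
apply: (@le_trans _ _ (T ^+ 2 * (A * S * (1 + 16 * rho * \sum_(k < M) (rho / 4) ^+ k)
    + e / T ^+ 2))).
  rewrite ler_pM2l//; apply: lerD; last exact/ltW/Ntail.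
  rewrite mulrDr mulr1; apply: lerD; first by have := sI 0; rewrite expr0 mulr1.
  rewrite mulrA mulr_sumr; apply: ler_sum => k _.
  have k4 : 0 < 16 / 4 ^+ k :> R by rewrite divr_gt0// exprn_gt0.
  apply: le_trans (_ : _ <= 16 / 4 ^+ k * (A * S * rho ^+ k.+1)) _.
    by rewrite ler_pM2l.
  by rewrite expr_div_n exprS le_eqVlt; apply/orP; left; apply/eqP; ring.
have ge : 1 + 16 * rho * \sum_(k < M) (rho / 4) ^+ k <= dyadic_constant alpha.
  rewrite lerD2l; apply: ler_wpM2l; first by rewrite mulr_ge0.
  exact/geometric_le/dyadic_ratio.
rewrite mulrDr [X in _ + X]mulrC divfK ?gt_eqF// lerD2r ler_pM2l//.
rewrite -(mulrA (dyadic_constant alpha)) [leRHS]mulrC.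
by apply: ler_wpM2l ge; rewrite mulr_ge0.
Qed.

End SpectralBounds.

(** * Rates of convergence *)

Section OperatorNorm.
Context {R : realType} {H : completeNormedModType R[i]}.
Variables (X : set H) (NX : H -> R).
Hypotheses (hX : submod_closed [in X]) (hNX : is_norm_on X NX).

(** [0 = NX (f - f) <= NX f + NX (- f) = 2 * NX f]. *)
Lemma norm_on_ge0 f : X f -> 0 <= NX f.
Proof.
move=> Xf; have XN : X (- f).
  have [X0 XD] := hX; have /set_mem := XD (-1) f 0 (mem_set Xf) X0.
  by rewrite scaleN1r addr0.
have NN : NX (- f) = NX f.
  by rewrite -scaleN1r (norm_onZ hNX)// normrN1 mul1r.
have N0 : NX 0 = 0 by rewrite -(scale0r f) (norm_onZ hNX)// normr0 mul0r.
by have := norm_onD hNX Xf XN; rewrite subrr N0 NN; lra.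
Qed.

Lemma opnorm_sqr_leP (T : H -> H) b : T 0 = 0 ->
  (opnorm X NX T ^+ 2 <= b%:E)%E <->
  0 <= b /\ forall f, X f -> rnorm (T f) ^+ 2 <= b * NX f ^+ 2.
Proof.
move=> T0; have op0 : (0 <= opnorm X NX T)%E by apply: ereal_sup_ubound; left.
split=> [le_b|[b0 le_b]].
  have b0 : 0 <= b by rewrite -lee_fin; apply: le_trans le_b; rewrite expe2 mule_ge0.
  split=> // f Xf; have [->|f0] := eqVneq f 0.
    by rewrite T0 rnorm0 expr0n mulr_ge0 ?sqr_ge0.
  have N0 : 0 < NX f.
    rewrite lt_neqAle norm_on_ge0// andbT eq_sym; apply/eqP => Nf0.
    by move/eqP : f0; apply; exact: (norm_on0 hNX).
  have q0 : 0 <= rnorm (T f) / NX f by rewrite divr_ge0 ?rnorm_ge0 ?ltW.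
  have leq : ((rnorm (T f) / NX f)%:E <= opnorm X NX T)%E.
    by apply: ereal_sup_ubound; right; exists f => //; split => //; exact/eqP.
  have := lee_pmul (_ : (0 <= (rnorm (T f) / NX f)%:E)%E) (_ : (0 <= (rnorm (T f) / NX f)%:E)%E) leq leq.
  rewrite !lee_fin -[X in (_ <= X)%E]expe2 => /(_ q0 q0)/le_trans/(_ le_b).
  by rewrite -EFinM lee_fin -expr2 expr_div_n ler_pdivrMr// exprn_gt0.
have : (opnorm X NX T <= (Num.sqrt b)%:E)%E.
  apply: ge_ereal_sup => _ [->|[f [Xf f0] <-]]; first by rewrite lee_fin sqrtr_ge0.
  have N0 : 0 < NX f.
    rewrite lt_neqAle norm_on_ge0// andbT eq_sym; apply/eqP => Nf0.
    by apply: f0; exact: (norm_on0 hNX).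
  rewrite lee_fin ler_pdivrMr// -(ler_pXn2r (ltn0Sn 1)) ?nnegrE ?rnorm_ge0//.
    by rewrite exprMn sqr_sqrtr// le_b.
  by rewrite mulr_ge0 ?sqrtr_ge0// ltW.
move=> le; rewrite expe2; apply: le_trans (lee_pmul op0 op0 le le) _.
by rewrite -EFinM lee_fin -expr2 sqr_sqrtr.
Qed.

End OperatorNorm.

Section Rates.
Local Open Scope complex_scope.
Context {R : realType} {H : completeNormedModType R[i]} {ip : innerProduct H}.
Variables (U : R -> {linear H -> H}).
Hypothesis hU : unitary_group ip U.
Variables (E : resolution ip).
Hypothesis hE : is_spectral_resolution E U.
Variable P : H -> H.
Hypothesis hP : is_orth_proj ip (fixed_vectors U) P.
Variables (X : set H) (NX : H -> R).
Hypotheses (hX : submod_closed [in X]) (hNX : is_norm_on X NX).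
Variable alpha : R.

(** The rate condition freed of the operator norm and of the starting time:
the integrals of the orbits of [f - P f] over [[0, T]] are bounded in terms of
[NX f]. *)
Definition primitive_bound B := forall f, X f -> forall G,
  primitive (fun x => U x (f - P f)) G -> G 0 = 0 ->
  forall T, 0 < T -> rnorm (G T) ^+ 2 <= T ^+ 2 * (B * T `^ (- alpha) * NX f ^+ 2).

Lemma proj0 : P 0 = 0.
Proof.
have [fixP /(_ _ fixP)] := hP 0; rewrite sub0r linearNl /= => /eqP.
rewrite oppr_eq0 -(dot_norm ip (P 0)) expf_eq0/= normr_eq0 => /eqP//.
Qed.

Lemma rnorm_time_avg f G s t : s < t ->
    primitive (fun x => U x (f - P f)) G -> G 0 = 0 ->
  rnorm (time_avg U t s f - P f) ^+ 2 = (t - s) ^- 2 * rnorm (G (t - s)) ^+ 2.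
Proof.
move=> st hG G0; have [fixP _] := hP f.
rewrite (time_avg_fixed hU st fixP hG G0) rnormZr (rnormU hU) exprMn.
by rewrite real_normK ?num_real// exprVn.
Qed.

Lemma time_avg_rateP :
  (exists2 B : R, 0 < B & forall t s : R, s < t ->
     (opnorm X NX (fun f => (time_avg U t s f - P f)%R) ^+ 2
       <= (B * (t - s) `^ (- alpha))%:E)%E) <->
  exists2 B, 0 < B & primitive_bound B.
Proof.
have avg0 t s : s < t -> time_avg U t s 0 - P 0 = 0.
  move=> st; apply: rnorm0_eq0; apply/eqP; rewrite -sqrf_eq0; apply/eqP.
  have prim0 : primitive (fun x => U x (0 - P 0)) (cst 0).
    move=> e e0; exists 1 => // p x q _ px xq _.
    rewrite proj0 subrr linear0 scaler0 !subr0 rnorm0 mulr_ge0 ?(ltW e0)//.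
    by rewrite subr_ge0 (le_trans px).
  by rewrite (rnorm_time_avg st prim0)// rnorm0 expr0n mulr0.
split=> -[B B0 hB]; exists B => //.
  move=> f Xf G hG G0 T T0; have := hB T 0 T0.
  rewrite (opnorm_sqr_leP hX hNX) ?avg0// => -[_ /(_ f Xf)].
  by rewrite (rnorm_time_avg T0 hG G0) subr0 ler_pdivrMl// exprn_gt0.
move=> t s st; have T0 : 0 < t - s by rewrite subr_gt0.
rewrite (opnorm_sqr_leP hX hNX) ?avg0//; split.
  by rewrite mulr_ge0 ?powR_ge0// ltW.
move=> f Xf; have [G hG G0] := orbit_primitive hU (f - P f).
rewrite (rnorm_time_avg st hG G0) ler_pdivrMl ?exprn_gt0//; exact: hB.
Qed.

Lemma Xbound_le h A A' : A <= A' -> Xbound E alpha h A -> Xbound E alpha h A'.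
Proof.
by move=> AA' hA d d0; apply: le_trans (hA d d0) _; rewrite lee_fin ler_wpM2r// powR_ge0.
Qed.

Lemma Xbound_inf_ge0 h : Xset E alpha h -> 0 <= inf (Xbound E alpha h).
Proof.
by move=> [A _ hA]; apply: lb_le_inf; [exists A|move=> A'; exact: Xbound_ge0].
Qed.

(** [spectral_measure_le_primitive] at [T = d^-1] turns the rate into
[Xbound]. *)
Lemma primitive_bound_X B : 0 < B -> primitive_bound B ->
  maps_continuously_into X NX (Xset E alpha) (Xnorm E alpha) (fun f => f - P f).
Proof.
move=> B0 hB.
have bd f : X f -> Xbound E alpha (f - P f) (4 * B * NX f ^+ 2).
  move=> Xf d d0; have [G hG G0] := orbit_primitive hU (f - P f).
  have dV0 : 0 < d^-1 by rewrite invr_gt0.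
  have := le_trans (spectral_measure_le_primitive hU hE hG G0 dV0) (hB f Xf G hG G0 _ dV0).
  rewrite invrK.
  have -> : d^-1 `^ (- alpha) = d `^ alpha.
    by rewrite -powR_inv1 ?(ltW d0)// -powRrM mulrNN mul1r.
  rewrite -mulrA ler_pM2l ?exprn_gt0// => le.
  have mI : measurable (`](- d), d]%classic : set (measurableTypeR R)).
    exact: measurable_itv.
  rewrite -[leLHS]fineK ?lee_fin; last first.
    rewrite ge0_fin_numE//; apply: le_lt_trans (spectral_measure_finite E (f - P f)).
    by apply: le_measure; rewrite ?inE.
  by move: le; rewrite ler_pdivrMl// => /le_trans; apply; rewrite le_eqVlt;
    apply/orP; left; apply/eqP; ring.
split.
  move=> _ [f Xf <-]; exists (4 * B * NX f ^+ 2 + 1).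
    by rewrite ltr_wpDl// mulr_ge0 ?sqr_ge0// mulr_ge0// ltW.
  by apply: Xbound_le (bd f Xf); rewrite lerDl.
exists (Num.sqrt (4 * B)) => f Xf; have N0 := norm_on_ge0 hX hNX Xf.
rewrite /Xnorm -[X in _ * X]ger0_norm// -sqrtr_sqr -sqrtrM ?mulr_ge0 ?(ltW B0)//.
rewrite ler_wsqrtr//; apply: ge_inf; last exact: bd.
by exists 0 => A; exact: Xbound_ge0.
Qed.

(** [primitive_le_Xbound] holds for every admissible constant, hence for their
infimum [Xnorm E alpha (f - P f) ^+ 2]. *)
Lemma X_primitive_bound : alpha < 2 ->
  maps_continuously_into X NX (Xset E alpha) (Xnorm E alpha) (fun f => f - P f) ->
  exists2 B, 0 < B & primitive_bound B.
Proof.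
move=> a2 [Xf_sub [C hC]]; set K : R := dyadic_constant alpha.
have K0 : 0 < K.
  have /andP[r0 r1] := @dyadic_ratio R _ a2.
  by rewrite /K /dyadic_constant ltr_wpDr// divr_ge0 ?mulr_ge0 ?powR_ge0// subr_ge0 ltW.
exists (K * C ^+ 2 + 1); first by rewrite ltr_wpDl// mulr_ge0 ?sqr_ge0// ltW.
move=> f Xf G hG G0 T T0.
have Xh : Xset E alpha (f - P f) by apply: Xf_sub; exists f.
have S0 : 0 < T `^ (- alpha) by rewrite powR_gt0.
have c0 : 0 < T ^+ 2 * (K * T `^ (- alpha)) by rewrite !mulr_gt0// exprn_gt0.
have : rnorm (G T) ^+ 2 / (T ^+ 2 * (K * T `^ (- alpha))) <= inf (Xbound E alpha (f - P f)).
  apply: lb_le_inf; first by have [A _ hA] := Xh; exists A.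
  move=> A hA; rewrite ler_pdivrMr//.
  apply: le_trans (primitive_le_Xbound hU hE hG G0 a2 hA T0) _.
  by rewrite le_eqVlt; apply/orP; left; apply/eqP; rewrite -/K; ring.
rewrite ler_pdivrMr// => /le_trans; apply.
have : inf (Xbound E alpha (f - P f)) <= (C * NX f) ^+ 2.
  rewrite -[leLHS]sqr_sqrtr ?Xbound_inf_ge0// lerXn2r ?nnegrE ?sqrtr_ge0 ?hC//.
  by apply: le_trans (hC f Xf); exact: sqrtr_ge0.
move=> /(ler_wpM2r (ltW c0))/le_trans; apply.
rewrite [leLHS]mulrC -[leLHS]mulrA ler_pM2l ?exprn_gt0//.
have := mulr_ge0 (ltW S0) (sqr_ge0 (NX f)).
set S := T `^ _; set N := NX f; move=> SN; rewrite exprMn.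
have -> : (K * C ^+ 2 + 1) * S * N ^+ 2 = K * S * (C ^+ 2 * N ^+ 2) + S * N ^+ 2 by ring.
by rewrite lerDl.
Qed.

(** For [alpha = 2] the powers of [T] cancel and the primitives are bounded
uniformly in time; being cocycles, they are coboundaries [U t g - g], which puts
[f - P f] in the range of the generator. *)
Lemma primitive_bound_Y B : alpha = 2 -> 0 < B -> primitive_bound B ->
  maps_continuously_into X NX (generator_range U) (Ynorm U) (fun f => f - P f).
Proof.
move=> a2 B0 hB.
have bd f G T : X f -> primitive (fun x => U x (f - P f)) G -> G 0 = 0 -> 0 < T ->
    rnorm (G T) <= Num.sqrt B * NX f.
  move=> Xf hG G0 T0; have N0 := norm_on_ge0 hX hNX Xf.
  rewrite -(ler_pXn2r (ltn0Sn 1)) ?nnegrE ?rnorm_ge0 ?mulr_ge0 ?sqrtr_ge0//.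
  apply: le_trans (hB f Xf G hG G0 T T0) _; rewrite a2 powR_invn ?(ltW T0)//.
  have -> : T ^+ 2 * (B * T ^- 2 * NX f ^+ 2) = B * NX f ^+ 2.
    by field; rewrite gt_eqF.
  by rewrite exprMn sqr_sqrtr ?(ltW B0).
split.
  move=> _ [f Xf <-]; have [G hG G0] := orbit_primitive hU (f - P f).
  have [g gG] := bounded_cocycle_coboundary hU
    (fun s t => primitive_cocycle hU hG G0) (fun T => bd f G T Xf hG G0).
  by exists ('i *: g); exact: (primitive_generator hU hG G0 gG).
exists (Num.sqrt B) => f Xf; have [G hG G0] := orbit_primitive hU (f - P f).
apply: ge_sup; first by eexists; exists 1 => //=.
move=> _ [T /= T0 <-]; rewrite (RInt_orbit hU T0 hG G0) (rnormU hU) subr0.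
exact: bd.
Qed.

(** If [f - P f] is the image of [g] under the generator, its primitive is
[- 'i *: (U t g - g)], of norm at most twice that of [g]; so the supremum defining [Ynorm] is
that of a bounded set. *)
Lemma Y_primitive_bound : alpha = 2 ->
  maps_continuously_into X NX (generator_range U) (Ynorm U) (fun f => f - P f) ->
  exists2 B, 0 < B & primitive_bound B.
Proof.
move=> a2 [Xf_sub [C hC]]; exists (C ^+ 2 + 1); first by rewrite ltr_wpDl ?sqr_ge0.
move=> f Xf G hG G0 T T0.
have [g gh] : generator_range U (f - P f) by apply: Xf_sub; exists f.
have RG s : 0 < s -> RInt (fun x => U x (f - P f)) 0 s = G s.
  by move=> s0; rewrite (RInt_orbit hU s0 hG G0) subr0 (ug0 hU).
have Gg s : 0 <= s -> G s = - 'i *: (U s g - g).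
  move=> s0; apply: (primitive_unique hG (generator_primitive hU gh)) => //.
  by rewrite (ug0 hU) subrr scaler0.
have GY : rnorm (G T) <= Ynorm U (f - P f).
  rewrite -RG//; apply: ub_le_sup; last by exists T.
  exists (rnorm g + rnorm g) => _ [s /= s0 <-].
  rewrite RG// Gg ?(ltW s0)// scaleNr rnormN rnorm_i.
  by apply: le_trans (rnormD _ _) _; rewrite rnormN (rnormU hU).
have le : rnorm (G T) ^+ 2 <= (C * NX f) ^+ 2.
  have := le_trans GY (hC f Xf) => le; rewrite lerXn2r ?nnegrE ?rnorm_ge0//.
  exact: le_trans (rnorm_ge0 _) le.
apply: le_trans le _; rewrite a2 powR_invn ?(ltW T0)//.
have -> : T ^+ 2 * ((C ^+ 2 + 1) * T ^- 2 * NX f ^+ 2) = (C ^+ 2 + 1) * NX f ^+ 2.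
  by field; rewrite gt_eqF.
by rewrite exprMn ler_wpM2r ?sqr_ge0// lerDl.
Qed.

End Rates.

Unset Implicit Arguments.

Theorem mainTheorem5 (R : realType) (H : completeNormedModType R[i])
    (ip : innerProduct H)
    (U : R -> {linear H -> H}) (hU : unitary_group ip U)
    (E : resolution ip) (hE : is_spectral_resolution E U)
    (P : H -> H) (hP : is_orth_proj ip (fixed_vectors U) P)
    (alpha : R) (halpha : 0 <= alpha <= 2)
    (X : set H) (hX : submod_closed [in X])
    (NX : H -> R) (hNX : is_norm_on X NX) :
  (exists2 B : R, 0 < B & forall t s : R, s < t ->
     (opnorm X NX (fun f => (time_avg U t s f - P f)%R) ^+ 2
       <= (B * (t - s) `^ (- alpha))%:E)%E)
  <->
  (alpha < 2 ->
     maps_continuously_into X NX (Xset E alpha) (Xnorm E alpha)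
       (fun f => f - P f)) /\
  (alpha = 2 ->
     maps_continuously_into X NX (generator_range U) (Ynorm U)
       (fun f => f - P f)).
Proof.
apply: (iff_trans (time_avg_rateP hU hP hX hNX alpha)).
have /andP[_ alpha2] := halpha.
split=> [[B B0 hB]|[XC YC]].
  split=> a2; first exact: (primitive_bound_X hU hE hX hNX B0 hB).
  exact: (primitive_bound_Y hU hX hNX a2 B0 hB).
move: alpha2; rewrite le_eqVlt => /orP[/eqP a2|a2].
  exact: (Y_primitive_bound hU a2 (YC a2)).
exact: (X_primitive_bound hU hE a2 (XC a2)).
Qed.
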